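(* Let $\{c_k\}_{k=1}^{\infty}$ be a nonnegative nonincreasing sequence of real numbers, and consider the series $\sum_{k=1}^{\infty}c_k\sin (k^{\alpha} x)$. Then: (a) if $\alpha$ is an even natural number and $E\subset\mathbb{R}$ is a set containing a point of the form $\frac{\pi}{2}+2\pi m$ or $\frac{2\pi}{3}+2\pi m$ with $m\in \mathbb{Z}$, then the series converges uniformly on $E$ if and only if $\sum_{k=1}^{\infty}c_k<\infty$; (b) if $\alpha$ is an odd natural number and $E\subset\mathbb{R}$ is a set containing, for some $\gamma\geq 2$, a discrete $(\alpha,\gamma)$-neighbourhood of zero, then the series converges uniformly on $E$ if and only if $c_kk\to 0$ as $k\to\infty$; (c) if $\alpha\in (0,2)$ is real and $E\subset\mathbb{R}$ is a bounded set containing, for some $\gamma\geq 2$, a discrete $(\alpha,\gamma)$-neighbourhood of zero, then the series converges uniformly on $E$ if and only if $c_kk\to 0$ as $k\to\infty$.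
   Context: Natural numbers are the positive integers. For real $\alpha>0$ and $\gamma>0$, a discrete $(\alpha,\gamma)$-neighbourhood of zero is a sequence $\{x_j\}_{j=0}^{\infty}$ of real numbers such that, for some $N\in\mathbb{N}$, $|x_j|=\frac{\pi}{\gamma^{\alpha+1}(N+j)^{\alpha}}$ for all integers $j\ge 0$ (the signs of the $x_j$ are arbitrary). A set contains such a neighbourhood if it contains all points $x_j$ of some such sequence. Uniform convergence on a set means uniform convergence of the partial sums $\sum_{k=1}^{L}$ in $x$ on that set as $L\to\infty$. *)

(* Defs.v *)
From mathcomp Require Import all_boot all_order all_algebra.
From mathcomp Require Import all_classical all_reals all_analysis.
Import Order.TTheory GRing.Theory Num.Theory.
Import numFieldNormedType.Exports.

Set Implicit Arguments.
Unset Strict Implicit.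
Unset Printing Implicit Defensive.

Local Open Scope classical_set_scope.
Local Open Scope ring_scope.

(* Sequences indexed by the positive integers are functions on [nat] whose
   value at 0 is never used. *)

Definition sin_partial_sum (R : realType) (c : nat -> R) (alpha : R)
    (L : nat) (x : R) : R :=
  \sum_(1 <= k < L.+1) c k * sin (k%:R `^ alpha * x).

Definition converges_uniformly_on (R : realType) (E : set R)
    (f : nat -> R -> R) : Prop :=
  exists g : R -> R, {uniform E, f @ \oo --> g}.

(* Only the absolute values are prescribed: the signs of the [x j] are free. *)
Definition discrete_nbhd0 (R : realType) (alpha gamma : R) (x : nat -> R) :
    Prop :=
  exists2 N : nat, (0 < N)%N &
    forall j : nat,
      `|x j| = pi / (gamma `^ (alpha + 1) * (N + j)%:R `^ alpha).

Definition contains_discrete_nbhd0 (R : realType) (alpha gamma : R)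
    (E : set R) : Prop :=
  exists2 x : nat -> R, discrete_nbhd0 alpha gamma x & range x `<=` E.

(* Main.v *)
(* Both sufficiency statements follow from one principle: if, uniformly in [x],
   the sums of [sin (k ^ alpha * x)] over the beginnings of the dyadic blocks
   [[2^j, 2^(j+1))] are at most [2^j * phi_j(x)] with [\sum_j phi_j(x)] bounded,
   then Abel summation on each block turns [k c_k -> 0] into uniform
   convergence.

   For [0 < alpha < 2], [alpha <> 1], the block bound is van der Corput's second
   derivative test.  For odd [alpha = a], write [x = 2 pi theta].  Weyl
   differencing shows that a block sum of size [2^j / K] forces
   [|theta - p / q| <= K^C / (q 2^(j a))] with [q <= K^C].  Comparing with this
   fraction, the complete sum of [sin (2 pi p k^a / q)] vanishes because [a] is
   odd, so [phi_j] is at most about [min (u, 1 / u)] with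
   [u = |theta - p / q| 2^(j a)], which is summable over the scales [j] sharing
   the same fraction.  Distinct fractions repel each other, so a fraction that
   appears after scale [m] has a denominator at least a power of [2^m], hence
   [phi_j] gains a factor geometric in [m], and the sum over all fractions stays
   bounded.

   Necessity in (b), (c): at the point of modulus [pi / (gamma^(alpha+1) n^alpha)]
   all the terms with [n < k <= 2 n] have the same sign and sines bounded away
   from 0.  In (a), [k ^ alpha] modulo 4 (or 3) is 0 or 1. *)

Require Import Defs.
From mathcomp Require Import all_boot all_order all_algebra.
From mathcomp Require Import all_classical all_reals all_analysis.
From mathcomp Require Import ring lra zify.
Import Order.TTheory GRing.Theory Num.Theory.
Import numFieldNormedType.Exports.

Set Implicit Arguments.
Unset Strict Implicit.
Unset Printing Implicit Defensive.

Local Open Scope ring_scope.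

(** * Kusmin-Landau and van der Corput *)

(** For odd [a] the obstacle is uniformity in [theta]: one [theta] can acquire new good rational
    approximations at arbitrarily many scales, so bounding each [phi_j] separately is not enough.
    Two choices resolve this. The Weyl parameter [K] is not fixed: at each scale it is comparable to
    the reciprocal of the normalized block sum, so a weak approximation occurs only where the sum is
    itself small. And a class of scales entered after scale [m] is controlled by the geometric mean
    of two bounds, one summable inside the class and one geometric in [m]. Since [K >= 2], powers of
    [K] absorb all numerical constants, so only the existence of an exponent is tracked. For real
    [alpha], with [y^2 = |x| N^alpha], the block bound is of order [y + N / y]. Divided by
    [N = 2^j], its first term decays geometrically in [j] because [alpha < 2], and boundedness of
    [E] makes this uniform. At [alpha = 1] the phase has no curvature, and the odd case takes
    over. *)

Ltac clear_reals :=
  repeat match goal with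
  | H : is_true (@Order.le _ _ _ _) |- _ => clear H
  | H : is_true (@Order.lt _ _ _ _) |- _ => clear H
  | H : is_true (@Order.le _ _ _ _ && _) |- _ => clear H
  | H : @eq (Real.sort _) _ _ |- _ => clear H
  | H : forall _, _ |- _ => clear H
  | H : set _ |- _ => clear H
  end.
Ltac natlia := clear_reals; lia.
Ltac natnia := clear_reals; nia.

Section Trig.
Variable R : realType.
Implicit Types x y : R.

Lemma cosD2pi_int x (m : int) : cos (x + 2 * pi * m%:~R) = cos x.
Proof.
have H y (n : nat) : cos (y + 2 * pi * n%:R) = cos y.
  rewrite -(periodicn (@cosD2pi R) n y); congr (cos (_ + _)).
  by rewrite -mulr_natr -[in RHS]mulr_natr; ring.
case: m => n; first exact: H.
rewrite NegzE -(H (x + _) n.+1); congr cos; rewrite mulrNz -[n.+1%:~R]/(n.+1%:R); ring.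
Qed.

Lemma sinD2pi_int x (m : int) : sin (x + 2 * pi * m%:~R) = sin x.
Proof. by rewrite -!cosBpihalf addrAC cosD2pi_int. Qed.

Lemma sin_le_id x : 0 <= x -> sin x <= x.
Proof.
rewrite le_eqVlt => /orP[/eqP<-|x0]; first by rewrite sin0.
have [|c _] := @MVT_segment R sin cos 0 x (ltW x0).
- by apply: continuous_subspaceT => z; exact: continuous_sin.
rewrite sin0 !subr0 => ->; rewrite -[leRHS]mul1r ler_wpM2r ?cos_le1//.
exact: ltW.
Qed.

Lemma norm_sin_le x : `|sin x| <= `|x|.
Proof.
wlog x0 : x / 0 <= x.
  move=> H; have [|x0] := leP 0 x; first exact: H.
  by rewrite -[x]opprK sinN normrN (normrN (- x)) H// oppr_ge0 ltW.
have [x1|x1] := leP x 1; last first.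
  by rewrite (le_trans (sin_max x))// ger0_norm// ltW.
rewrite !ger0_norm ?sin_le_id// sin_ge0_pi// x0 (le_trans x1)//.
by rewrite (le_trans _ (@pi_ge2 R))// ler1n.
Qed.

(* [tan y >= y] at [y = x / 2] *)
Lemma cos_half_le x : 0 < x -> x <= pi -> x * cos (x / 2) <= 2 * sin (x / 2).
Proof.
move=> x0 xpi; set y := x / 2.
have y0 : 0 < y by rewrite /y; lra.
have [||c cy] := @MVT_segment R (fun z => sin z - z * cos z) (fun z => z * sin z) 0 y (ltW y0).
- move=> z _; apply: is_derive_eq; rewrite /GRing.scale/=; ring.
- apply: continuous_subspaceT => z.
  apply: differentiable_continuous.
  by apply/derivable1_diffP.
rewrite sin0 mul0r !subr0 => E.
have : 0 <= c * sin c * y.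
  move: cy; rewrite in_itv/= => /andP[c0 cy].
  apply: mulr_ge0; last exact: ltW.
  apply: mulr_ge0 => //; apply: sin_ge0_pi; rewrite c0/=; rewrite /y in cy; lra.
rewrite -E /y => H; nra.
Qed.

End Trig.

Section Abel.
Variable R : realType.
Implicit Types g b f : nat -> R.

(** Total variation replaces monotonicity because [major_arc] applies this to oscillating weights,
    the sine and cosine of a slowly varying phase. *)
Lemma abel_variation g b (M n : nat) (B : R) : (M <= n)%N ->
  (forall m, (M <= m <= n)%N -> `|\sum_(M <= k < m) b k| <= B) ->
  `|\sum_(M <= k < n) g k * b k| <=
    B * (`|g n| + \sum_(M <= k < n) `|g k.+1 - g k|).
Proof.
move=> Mn HB.
have E : \sum_(M <= k < n) g k * b k = g n * \sum_(M <= k < n) b k -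
    \sum_(M <= k < n) (g k.+1 - g k) * \sum_(M <= l < k.+1) b l.
  elim: n Mn {HB} => [|n IH] Mn.
    by rewrite !big_geq// mulr0 subr0.
  move: Mn; rewrite leq_eqVlt => /orP[/eqP<-|Mn].
    by rewrite !big_geq// mulr0 subr0.
  rewrite ltnS in Mn.
  rewrite !big_nat_recr//= IH//; ring.
have HS m : (M <= m <= n)%N -> `|\sum_(M <= k < m) b k| <= B by apply: HB.
rewrite E (le_trans (ler_normB _ _))// mulrDr lerD//.
  by rewrite normrM mulrC ler_wpM2r// HS// Mn leqnn.
rewrite (le_trans (ler_norm_sum _ _ _))// mulr_sumr.
rewrite [leLHS]big_nat [leRHS]big_nat.
apply: ler_sum => k /andP[Mk kn]; rewrite normrM mulrC ler_wpM2r// HS//.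
by rewrite kn (leq_trans Mk).
Qed.

Lemma sum_norm_nonincr g (M n : nat) : (M <= n)%N ->
  (forall k, (M <= k < n)%N -> g k.+1 <= g k) ->
  \sum_(M <= k < n) `|g k.+1 - g k| = g M - g n.
Proof.
move=> Mn Hg; rewrite -[RHS]opprB -telescope_sumr// -sumrN.
by apply: eq_big_nat => k kn; rewrite ler0_norm// subr_le0 Hg.
Qed.

Lemma abel_nonincr g b (M n : nat) (B : R) : (M < n)%N ->
  (forall k, (M <= k < n)%N -> 0 <= g k) ->
  (forall k, (M <= k)%N -> (k.+1 < n)%N -> g k.+1 <= g k) ->
  (forall m, (M <= m <= n)%N -> `|\sum_(M <= k < m) b k| <= B) ->
  `|\sum_(M <= k < n) g k * b k| <= B * g M.
Proof.
move=> Mn g0 gd HB; pose g' k := if (k < n)%N then g k else 0.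
have -> : \sum_(M <= k < n) g k * b k = \sum_(M <= k < n) g' k * b k.
  by apply: eq_big_nat => k /andP[_ kn]; rewrite /g' kn.
apply: (le_trans (abel_variation g' (ltnW Mn) HB)).
rewrite sum_norm_nonincr; last 2 first.
- exact: ltnW.
- move=> k /andP[Mk kn]; rewrite /g' kn; case: ifPn => kn'; first exact: gd.
  by apply: g0; rewrite Mk.
by rewrite /g' ltnn Mn normr0 add0r subr0.
Qed.

End Abel.

Section KusminLandau.
Variable R : realType.
Implicit Types f : nat -> R.

(** It arises from [1 / (e^(ix) - 1) = - 1/2 - (i/2) cot (x/2)]. *)
Definition cot_half (x : R) := cos (x / 2) / sin (x / 2).

Lemma sin_half_gt0 (x : R) : 0 < x -> x < 2 * pi -> 0 < sin (x / 2).
Proof. by move=> x0 xpi; apply: sin_gt0_pi; apply/andP; split; lra. Qed.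

(* Real part of [e^(ia) = (e^(i(a+d)) - e^(ia)) / (e^(id) - 1)]. *)
Lemma cos_cot_half (a d : R) : sin (d / 2) != 0 ->
  cos a = - (1 / 2) * (cos (a + d) - cos a)
          + 1 / 2 * (cot_half d * (sin (a + d) - sin a)).
Proof.
set y := d / 2 => s0.
have -> : a + d = (a + y) + y by rewrite /y; field.
have H b : cos (b - y) = - (1 / 2) * (cos (b + y) - cos (b - y))
    + 1 / 2 * (cot_half d * (sin (b + y) - sin (b - y))).
  by rewrite /cot_half -/y !cosB !sinB !cosD !sinD; field; exact: s0.
by have := H (a + y); rewrite addrK.
Qed.

Lemma cot_half_le (x y : R) : 0 < x -> x <= y -> y < 2 * pi ->
  cot_half y <= cot_half x.
Proof.
move=> x0 xy ypi; rewrite /cot_half.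
have sx : 0 < sin (x / 2) by apply: sin_half_gt0 => //; lra.
have sy : 0 < sin (y / 2) by apply: sin_half_gt0 => //; lra.
rewrite ler_pdivrMr// mulrAC ler_pdivlMr//.
have : 0 <= sin (y / 2 - x / 2).
  by apply: sin_ge0_pi; apply/andP; split; have := pi_gt0 R; lra.
by rewrite sinB; nra.
Qed.

(** The function decreases and is antisymmetric about [pi], so the extreme values sit at [d] and
    [2 pi - d]; there [cos_half_le] applies. *)
Lemma cot_half_norm (d x : R) : 0 < d -> d <= pi -> d <= x -> x <= 2 * pi - d ->
  `|cot_half x| <= 2 / d.
Proof.
move=> d0 dpi dx xd.
have sd : 0 < sin (d / 2) by apply: sin_half_gt0 => //; lra.
have cd : cot_half d <= 2 / d.
  rewrite /cot_half ler_pdivrMr// mulrAC ler_pdivlMr// mulrC.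
  exact: cos_half_le.
rewrite ler_norml; apply/andP; split; last first.
  by apply: le_trans cd; apply: cot_half_le => //; lra.
apply: (@le_trans _ _ (cot_half (2 * pi - d))); last by apply: cot_half_le => //; lra.
have -> : cot_half (2 * pi - d) = - cot_half d.
  rewrite /cot_half; have -> : (2 * pi - d) / 2 = - (d / 2) + pi by field.
  by rewrite sinDpi cosDpi sinN cosN opprK mulNr.
by rewrite lerN2.
Qed.

(** By [cos_cot_half] each term is a difference of cosines, which telescopes, plus a difference of
    sines with a monotone bounded weight, to which Abel summation applies. *)
Lemma kusmin_landau_nondecr f (M n : nat) (d : R) : 0 < d -> d <= pi ->
  (forall k, (M <= k < n)%N -> d <= f k.+1 - f k <= 2 * pi - d) ->
  (forall k, (M <= k)%N -> (k.+1 < n)%N ->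
     f k.+1 - f k <= f k.+2 - f k.+1) ->
  `|\sum_(M <= k < n) cos (f k)| <= 1 + 6 / d.
Proof.
move=> d0 dpi Hd Hmono.
have d6 : 0 < 6 / d by rewrite divr_gt0.
have [nM|Mn] := leqP n M; first by rewrite big_geq// normr0; lra.
(* The shift by [2 / d] makes the weight nonnegative, as [abel_nonincr] requires; its contribution
   is subtracted again as a telescoping sum. *)
pose g k := cot_half (f k.+1 - f k) + 2 / d.
pose b k := sin (f k.+1) - sin (f k).
have telb m : (M <= m)%N -> \sum_(M <= k < m) b k = sin (f m) - sin (f M).
  by move=> Mm; rewrite -(telescope_sumr (fun k => sin (f k))).
have bB m : (M <= m <= n)%N -> `|\sum_(M <= k < m) b k| <= 2.
  move=> /andP[Mm _]; rewrite telb// (le_trans (ler_normB _ _))//.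
  by have := sin_max (f m); have := sin_max (f M); lra.
have gB k : (M <= k < n)%N -> 0 <= g k <= 4 / d.
  move=> /Hd/andP[h1 h2].
  by have := cot_half_norm d0 dpi h1 h2; rewrite ler_norml /g; lra.
have E : \sum_(M <= k < n) cos (f k) = - (1 / 2) * (cos (f n) - cos (f M))
    + 1 / 2 * (\sum_(M <= k < n) g k * b k - 2 / d * \sum_(M <= k < n) b k).
  rewrite -(telescope_sumr (fun k => cos (f k)) (ltnW Mn)).
  rewrite ![_ * \sum_(_ <= _ < _) _]mulr_sumr -sumrB mulr_sumr -big_split/=.
  apply: eq_big_nat => k /Hd/andP[h1 h2].
  rewrite {1}(@cos_cot_half (f k) (f k.+1 - f k)).
    by rewrite subrKC /g /b; ring.
  by rewrite gt_eqF// sin_half_gt0; lra.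
have H1 : `|\sum_(M <= k < n) g k * b k| <= 2 * (4 / d).
  have gM := gB M; rewrite leqnn Mn in gM.
  apply: (@le_trans _ _ (2 * g M)); last by have := gM isT; lra.
  apply: abel_nonincr => //.
    by move=> k /gB/andP[].
  move=> k Mk kn; rewrite /g lerD2r; apply: cot_half_le.
  - by have := Hd k; rewrite Mk (ltnW kn) => /(_ isT); lra.
  - exact: Hmono.
  - by have := Hd k.+1; rewrite kn (leqW Mk) => /(_ isT); lra.
have H2 : `|2 / d * \sum_(M <= k < n) b k| <= 4 / d.
  rewrite normrM ger0_norm; last by rewrite divr_ge0// ltW.
  have := bB n; rewrite leqnn (ltnW Mn) => /(_ isT) h.
  apply: (le_trans (ler_wpM2l _ h)); first by rewrite divr_ge0// ltW.
  lra.
rewrite E; move: H1 H2.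
have := cos_max (f n); have := cos_max (f M); rewrite !ler_norml.
move: (\sum_(M <= k < n) g k * b k) (2 / d * \sum_(M <= k < n) b k) => u v.
move: (cos _) (cos _) => c1 c2; lra.
Qed.

Lemma kusmin_landau f (M n : nat) (d : R) (l : int) : 0 < d -> d <= pi ->
  (forall k, (M <= k < n)%N ->
     2 * pi * l%:~R + d <= f k.+1 - f k <= 2 * pi * l%:~R + 2 * pi - d) ->
  (forall k, (M <= k)%N -> (k.+1 < n)%N ->
     f k.+1 - f k <= f k.+2 - f k.+1) ->
  `|\sum_(M <= k < n) cos (f k)| <= 1 + 6 / d.
Proof.
move=> d0 dpi Hd Hm.
(* Removing [2 pi l k] changes no cosine and brings the slopes into the base period. *)
pose f' k := f k + 2 * pi * (- l * k%:Z)%:~R.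
rewrite (eq_bigr (fun k => cos (f' k))); last by move=> k _; rewrite cosD2pi_int.
have E k : f' k.+1 - f' k = f k.+1 - f k - 2 * pi * l%:~R.
  by rewrite /f' !intrM mulrNz -!pmulrn -natr1; ring.
apply: kusmin_landau_nondecr => // k.
  by move=> /Hd; rewrite E; lra.
by move=> Mk kn; rewrite !E lerD2r Hm.
Qed.

End KusminLandau.

Section SecondDerivative.
Variable R : realType.
Implicit Types f : nat -> R.

Lemma norm_sum_cos_le f (M n : nat) : `|\sum_(M <= k < n) cos (f k)| <= (n - M)%:R.
Proof.
rewrite (le_trans (ler_norm_sum _ _ _))//.
rewrite -[leRHS]mulr1 mulr_natl -sumr_const_nat.
by apply: ler_sum => k _; exact: cos_max.
Qed.

Lemma split_threshold (d : nat -> R) (M n : nat) (t : R) : (M <= n)%N ->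
  (forall k, (M <= k)%N -> (k.+1 < n)%N -> d k <= d k.+1) ->
  exists s, [/\ (M <= s <= n)%N, forall k, (M <= k < s)%N -> d k < t &
    forall k, (s <= k < n)%N -> t <= d k].
Proof.
elim: n => [|n IH] Mn Hd.
  by exists M; rewrite leqnn Mn; split => // k; natlia.
have [Mn'|] := leqP M n; last first.
  by move=> nM; exists M; rewrite leqnn Mn; split => // k; natlia.
have [|s [/andP[Ms sn] h1 h2]] := IH Mn'.
  by move=> k Mk kn; apply: Hd => //; natlia.
have [dn|dn] := leP t (d n).
  exists s; split => //; first natlia.
  move=> k /andP[sk]; rewrite ltnS leq_eqVlt => /orP[/eqP->//|kn].
  by apply: h2; rewrite sk.
exists n.+1; split; [natlia| |move=> k; natlia].
move=> k /andP[Mk]; rewrite ltnS => kn; apply: le_lt_trans dn.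
have {h1 h2 s Ms sn} H j : (k + j <= n)%N -> d k <= d (k + j)%N.
  elim: j => [|j IHj] kj; first by rewrite addn0.
  by rewrite addnS; apply: (le_trans (IHj _)); [natlia|apply: Hd; natlia].
by have := H (n - k)%N; rewrite subnKC//; apply.
Qed.

Variables (f : nat -> R) (lam dl : R).
Let d k := f k.+1 - f k.
Hypotheses (lam0 : 0 < lam) (dl0 : 0 < dl) (dlpi : dl <= pi).

(** Slopes growing by at least [lam] per step stay in an interval of length [dl] for at most
    [dl / lam + 1] terms, each bounded by 1. *)
Lemma short_interval (M n : nat) (t : R) :
  (forall k, (M <= k)%N -> (k.+1 < n)%N -> d k + lam <= d k.+1) ->
  (forall k, (M <= k < n)%N -> t <= d k <= t + dl) ->
  `|\sum_(M <= k < n) cos (f k)| <= dl / lam + 1.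
Proof.
move=> Hl Hd.
have dl' : 0 < dl / lam by rewrite divr_gt0.
have [nM|Mn] := leqP n M; first by rewrite big_geq// normr0; lra.
apply: (le_trans (norm_sum_cos_le _ _ _)).
have H j : (M + j < n)%N -> d M + lam * j%:R <= d (M + j)%N.
  elim: j => [|j IH] kj; first by rewrite addn0 mulr0 addr0.
  rewrite addnS -natr1; have := IH (ltnW _); rewrite -addnS => /(_ kj).
  by have := @Hl (M + j)%N; rewrite -addnS leq_addr => /(_ isT kj); lra.
have := H (n - M).-1; have -> : (M + (n - M).-1)%N = n.-1 by natlia.
have -> : (n.-1 < n)%N by natlia.
move=> /(_ isT) H1; have := Hd M; rewrite leqnn Mn => /(_ isT) H2.
have := Hd n.-1; have -> : (M <= n.-1 < n)%N by natlia.
move=> /(_ isT) H3.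
have -> : (n - M)%:R = (n - M).-1%:R + 1 :> R by rewrite natr1 prednK//; natlia.
by rewrite lerD2r ler_pdivlMr// mulrC; lra.
Qed.

(** Cost of one period of the slope: Kusmin-Landau at distance at least [dl] from the multiples of
    [2 pi], and two end pieces counted trivially. *)
Definition vdc_const := 1 + 6 / dl + 2 * (dl / lam + 1).

Lemma one_period (M n : nat) (l : int) : (M <= n)%N ->
  (forall k, (M <= k)%N -> (k.+1 < n)%N -> d k + lam <= d k.+1) ->
  (forall k, (M <= k < n)%N ->
     2 * pi * l%:~R <= d k < 2 * pi * l%:~R + 2 * pi) ->
  `|\sum_(M <= k < n) cos (f k)| <= vdc_const.
Proof.
move=> Mn Hl Hd; set t := 2 * pi * l%:~R in Hd.
have Hm k : (M <= k)%N -> (k.+1 < n)%N -> d k <= d k.+1.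
  by move=> h1 h2; apply: le_trans (Hl _ h1 h2); rewrite lerDl ltW.
have [s [/andP[Ms sn] h1 h2]] := split_threshold (t + dl) Mn Hm.
have [|u [/andP[su un] h3 h4]] := @split_threshold d s n (t + 2 * pi - dl) sn.
  by move=> k sk; apply: Hm; natlia.
rewrite (big_cat_nat Ms sn) (big_cat_nat su un)/=.
have A1 : `|\sum_(M <= k < s) cos (f k)| <= dl / lam + 1.
  apply: (@short_interval _ _ t).
    by move=> k Mk ks; apply: Hl => //; natlia.
  move=> k Hk; have := h1 k Hk; have := Hd k; have -> : (M <= k < n)%N by natlia.
  by move=> /(_ isT); lra.
have A2 : `|\sum_(u <= k < n) cos (f k)| <= dl / lam + 1.
  apply: (@short_interval _ _ (t + 2 * pi - dl)).
    by move=> k Mk ks; apply: Hl => //; natlia.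
  move=> k Hk; have := h4 k Hk; have := Hd k; have -> : (M <= k < n)%N by natlia.
  by move=> /(_ isT); lra.
have A3 : `|\sum_(s <= k < u) cos (f k)| <= 1 + 6 / dl.
  apply: (@kusmin_landau _ _ _ _ _ l) => // k.
    move=> Hk; have := h3 k Hk; have := h2 k; have -> : (s <= k < n)%N by natlia.
    by move=> /(_ isT); rewrite -/t /d; lra.
  by move=> sk ku; apply: Hm; natlia.
rewrite /vdc_const; move: A1 A2 A3; rewrite !ler_norml; lra.
Qed.

Lemma van_der_corput (v M n : nat) (l : int) : (M <= n)%N ->
  (forall k, (M <= k)%N -> (k.+1 < n)%N -> d k + lam <= d k.+1) ->
  (forall k, (M <= k < n)%N ->
     2 * pi * l%:~R <= d k < 2 * pi * l%:~R + 2 * pi * v%:R) ->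
  `|\sum_(M <= k < n) cos (f k)| <= v%:R * vdc_const.
Proof.
elim: v n => [|v IH] n Mn Hl Hd.
  rewrite mul0r big_nat big1 ?normr0// => k /Hd; lra.
have Hm k : (M <= k)%N -> (k.+1 < n)%N -> d k <= d k.+1.
  by move=> h1 h2; apply: le_trans (Hl _ h1 h2); rewrite lerDl ltW.
have [s [/andP[Ms sn] h1 h2]] :=
  split_threshold (2 * pi * l%:~R + 2 * pi * v%:R) Mn Hm.
rewrite (big_cat_nat Ms sn)/= (le_trans (ler_normD _ _))//.
rewrite -natr1 mulrDl mul1r lerD//.
  apply: IH => // k.
    by move=> Mk ks; apply: Hl => //; natlia.
  move=> Hk; have := h1 k Hk; have := Hd k; have -> : (M <= k < n)%N by natlia.
  by move=> /(_ isT); lra.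
apply: (@one_period _ _ (l + v%:Z)) => //.
  by move=> k Mk ks; apply: Hl => //; natlia.
move=> k Hk; have := h2 k Hk; have := Hd k; have -> : (M <= k < n)%N by natlia.
by move=> /(_ isT); rewrite intrD -pmulrn -natr1; lra.
Qed.

End SecondDerivative.

(** * Weyl sums *)

Section Diophantine.
Variable R : realType.

Definition near_int (y e : R) := exists p : int, `|y - p%:~R| <= e.

Lemma near_int_le (y e e' : R) : e <= e' -> near_int y e -> near_int y e'.
Proof. by move=> ee' [p hp]; exists p; exact: le_trans ee'. Qed.

Lemma near_int_small (y e : R) : near_int y e -> `|y| + e < 1 -> `|y| <= e.
Proof.
move=> [p hp] h; suff p0 : p = 0 by move: hp; rewrite p0 subr0.
have : `|p%:~R : R| < 1.
  have : `|p%:~R : R| <= `|y| + `|y - p%:~R|.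
    by rewrite -{1}(subKr y p%:~R); exact: ler_normB.
  lra.
by rewrite -intr_norm -[1]/(1%:~R) ltr_int; lia.
Qed.

Lemma near_intB (x y e1 e2 : R) : near_int x e1 -> near_int y e2 ->
  near_int (x - y) (e1 + e2).
Proof.
move=> [p hp] [q hq]; exists (p - q); rewrite intrB.
have -> : x - y - (p%:~R - q%:~R) = (x - p%:~R) - (y - q%:~R) by ring.
by apply: (le_trans (ler_normB _ _)); exact: lerD.
Qed.

(** Pigeonhole with boxes of length [2 L]: one element per box would give
    [#|H| * L <= n / 2 + L < n]. *)
Lemma exists_close_pair (n L : nat) (H : {set 'I_n}) : (0 < L)%N ->
  (n <= #|H| * L)%N -> (2 * L < n)%N ->
  exists h h' : 'I_n, [/\ h \in H, h' \in H, (h' < h)%N & (h - h' < 2 * L)%N].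
Proof.
move=> L0 HL nL; apply: contrapT => no.
have inj : {in H &, injective (fun h : 'I_n => inord (h %/ (2 * L)) : 'I_(n %/ (2 * L)).+1)}.
  move=> h h' hH h'H /(congr1 (@nat_of_ord _)); rewrite !inordK; last 2 first.
  - by rewrite ltnS leq_div2r// ltnW.
  - by rewrite ltnS leq_div2r// ltnW.
  move=> E; apply/val_inj/eqP => /=; rewrite eqn_leq; apply/andP.
  have d1 := divn_eq h (2 * L); have d2 := divn_eq h' (2 * L).
  have m1 := @ltn_pmod h (2 * L) _; have m2 := @ltn_pmod h' (2 * L) _.
  rewrite E in d1.
  split; rewrite leqNgt; apply/negP => lt; apply: no.
    by exists h, h'; split => //; lia.
  by exists h', h; split => //; lia.
have := (@leq_card_in _ _ _ _ inj); rewrite card_ord => hc.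
have : (n <= (n %/ (2 * L)).+1 * L)%N by apply: leq_trans HL _; rewrite leq_mul2r hc orbT.
have := divn_eq n (2 * L); nia.
Qed.

(* Two close elements of [H] provide [q]. Let [a = |q g - p|]. On a window of
   length [T ~ q / (2 a)] the drift of [h g] along a class modulo [q] stays below
   [1 / 2], so the class meets [H] at most [W ~ 2 e / a] times there; counting the
   windows and classes bounds [a]. *)
Lemma vinogradov (g e : R) (n L : nat) (H : {set 'I_n}) : (0 < L)%N ->
  (n <= #|H| * L)%N -> (forall h, h \in H -> near_int (h%:R * g) e) ->
  0 <= e -> 32 * L%:R * e <= 1 -> (8 * L ^ 2 <= n)%N ->
  exists2 q : nat, (0 < q <= 2 * L)%N &
    near_int (q%:R * g) (16 * e * L%:R ^+ 2 / n%:R).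
Proof.
move=> L0 HL Hg e0 eL nL.
have L1 : 1 <= L%:R :> R by rewrite ler1n.
have [|h1 [h2 [h1H h2H lt12 close]]] := exists_close_pair L0 HL; first nia.
pose q := (h1 - h2)%N.
have q0 : (0 < q)%N by rewrite subn_gt0.
have [p hp] : near_int (q%:R * g) (2 * e).
  rewrite /q natrB ?(ltnW lt12)// mulrBl (_ : 2 * e = e + e); last by ring.
  by apply: near_intB; exact: Hg.
exists q; first by rewrite q0 ltnW.
exists p; set eta := q%:R * g - p%:~R in hp *.
have [a aE] : exists a : R, a = `|eta| by exists `|eta|.
rewrite -aE in hp *.
have n0 : 0 < n%:R :> R by rewrite ltr0n; natlia.
have [->|a0] := eqVneq a 0.
  by rewrite divr_ge0// !mulr_ge0// exprn_ge0.
have {}a0 : 0 < a by rewrite lt_def a0 aE normr_ge0.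
have q1 : 1 <= q%:R :> R by rewrite ler1n.
have eL16 : e <= 1 / 32.
  by have : 32 * 1 * e <= 32 * L%:R * e; [rewrite ler_wpM2r// ler_wpM2l|lra].
have e0' : 0 < e by lra.
pose T := Num.truncn (q%:R / (2 * a)); pose W := (Num.truncn (2 * e / a)).+1.
have qa0 : 0 <= q%:R / (2 * a) by rewrite divr_ge0//; lra.
have ea0 : 0 <= 2 * e / a by rewrite divr_ge0//; lra.
have /andP[T1 T2] := truncn_itv qa0; have /andP[W1 W2] := truncn_itv ea0.
rewrite -/T in T1 T2; rewrite -/W in W2.
have qa4 : 1 <= q%:R / (4 * a) by rewrite ler_pdivlMr; lra.
have qa24 : q%:R / (2 * a) = 2 * (q%:R / (4 * a)) by field; rewrite gt_eqF.
have Tlow : q%:R / (4 * a) <= T%:R by move: T2; rewrite -(natr1 T); lra.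
have T0 : (0 < T)%N by rewrite -(ltr0n R); lra.
have hF (h : 'I_n) : (h %/ T < (n %/ T).+1)%N.
  by rewrite ltnS leq_div2r// ltnW.
(* Window, residue modulo [q], and quotient by [q] modulo [W]. Injectivity of [F] on [H] yields
   [#|H| <= (n / T + 1) q W]. *)
pose F (h : 'I_n) := (Ordinal (hF h),
  Ordinal (ltn_pmod h q0), Ordinal (ltn_pmod (h %/ q) (ltn0Sn _ : (0 < W)%N))).
have injlt (h h' : 'I_n) : h \in H -> h' \in H -> F h = F h' -> ~~ (h' < h)%N.
  move=> hH h'H [E1 E2 E3].
  apply/negP => lt; pose t := (h %/ q - h' %/ q)%N.
  have d1 := divn_eq h T; have d2 := divn_eq h' T.
  have m1 := ltn_pmod h T0; have m2 := ltn_pmod h' T0.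
  have d3 := divn_eq h q; have d4 := divn_eq h' q.
  rewrite E1 in d1; rewrite E2 in d3.
  have tq : (h - h' = t * q)%N.
    by rewrite /t mulnBl [X in (X - _)%N = _]d3 [X in (_ - X)%N = _]d4 subnDr.
  have hT : (h - h' < T)%N.
    rewrite [X in (X - _)%N]d1 [X in (_ - X)%N]d2 subnDl.
    exact: leq_ltn_trans (leq_subr _ _) m1.
  have t0 : (0 < t)%N by rewrite lt0n; apply/eqP => t0; move/eqP: tq; rewrite t0 mul0n subn_eq0 leqNgt lt.
  have ta : t%:R * a <= 1 / 2.
    have : t%:R * q%:R <= q%:R / (2 * a) :> R.
      by rewrite -natrM -tq (le_trans _ T1)// ler_nat ltnW.
    rewrite [_ * q%:R]mulrC ler_pM2l; last lra.
    by rewrite -[(2 * a)^-1]mul1r ler_pdivlMr; lra.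
  have ht : near_int (t%:R * eta) (2 * e).
    have -> : t%:R * eta = (h%:R * g - h'%:R * g) - (t%:Z * p)%:~R.
      have -> : h%:R * g - h'%:R * g = t%:R * q%:R * g.
        by rewrite -mulrBl -natrB ?(ltnW lt)// tq natrM.
      by rewrite /eta intrM -pmulrn; ring.
    have [u hu] := near_intB (Hg _ hH) (Hg _ h'H).
    exists (u - t%:Z * p); rewrite intrB opprB addrA subrK.
    by apply: (le_trans hu); lra.
  have nta : `|t%:R * eta| = t%:R * a by rewrite normrM normr_nat aE.
  (* [t eta] is within [2 e] of an integer and at most [1 / 2] in size, so that integer is 0. Hence
     [t a <= 2 e], so [t < W], and equal residues modulo [W] force [t = 0]. *)
  have := near_int_small ht; rewrite nta => tae; have {}tae := tae ltac:(lra).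
  have tW : (t < W)%N.
    by rewrite -(ltr_nat R); apply: le_lt_trans W2; rewrite ler_pdivlMr.
  have : (t %% W = 0)%N.
    apply/eqP; rewrite -/(W %| t)%N /t -eqn_mod_dvd; first exact/eqP.
    by rewrite leq_div2r// ltnW.
  by rewrite modn_small// => tz; rewrite tz in t0.
have inj : {in H &, injective F}.
  move=> h h' hH h'H E; apply/val_inj/eqP => /=; rewrite eqn_leq.
  by apply/andP; split; rewrite leqNgt; apply: injlt.
have := (@leq_card_in _ _ _ _ inj); rewrite !card_prod !card_ord => hc.
have hcR : n%:R <= (n %/ T).+1%:R * q%:R * W%:R * L%:R :> R.
  rewrite -!natrM ler_nat; apply: leq_trans HL _; rewrite leq_mul2r.
  by rewrite hc orbT.
have nT : (n %/ T)%:R <= 4 * a * n%:R / q%:R :> R.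
  have : (n %/ T)%:R * T%:R <= n%:R :> R by rewrite -natrM ler_nat leq_divM.
  move=> h; rewrite ler_pdivlMr; last lra.
  have : (n %/ T)%:R * (q%:R / (4 * a)) <= n%:R :> R.
    by apply: le_trans h; rewrite ler_wpM2l.
  by rewrite mulrA ler_pdivrMr; last lra; move=> h'; lra.
have WW : W%:R <= 2 * e / a + 1 by rewrite /W -(natr1 (Num.truncn _)) lerD2r.
have q2L : q%:R <= 2 * L%:R :> R by rewrite -natrM ler_nat ltnW.
have nL2 : 8 * L%:R ^+ 2 <= n%:R :> R by rewrite -natrX -natrM ler_nat.
rewrite ler_pdivlMr//.
have B1 : (n %/ T).+1%:R * q%:R <= 4 * a * n%:R + q%:R.
  rewrite -(natr1 (n %/ T)) mulrDl mul1r lerD2r; move: nT; rewrite ler_pdivlMr; lra.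
have B2 : n%:R <= (4 * a * n%:R + q%:R) * (2 * e / a + 1) * L%:R.
  apply: (le_trans hcR); by rewrite ler_wpM2r// ler_pM// mulr_ge0.
have B3 : (4 * a * n%:R + q%:R) * (2 * e / a + 1) * L%:R =
   8 * e * n%:R * L%:R + 4 * a * n%:R * L%:R + 2 * e * (q%:R * L%:R) / a + q%:R * L%:R.
  by field; rewrite gt_eqF.
rewrite B3 in B2.
(* Of the four terms in [B2], the first, second and fourth are at most [n / 4] each, so the third is
   at least [n / 4]; this is the desired bound on [a]. *)
have B4 : a * (n%:R * L%:R) <= 2 * e * (n%:R * L%:R) by rewrite ler_wpM2r// mulr_ge0.
have B5 : 32 * L%:R * e * n%:R <= 1 * n%:R by rewrite ler_wpM2r.
have B6 : q%:R * L%:R <= 2 * L%:R ^+ 2 :> R.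
  by rewrite expr2 mulrA ler_wpM2r.
have B7 : 2 * e * (q%:R * L%:R) / a <= 4 * e * L%:R ^+ 2 / a.
  rewrite ler_wpM2r ?invr_ge0 ?(ltW a0)//.
  have := ler_wpM2l e0 B6; lra.
have B8 : n%:R / 4 <= 4 * e * L%:R ^+ 2 / a by lra.
by move: B8; rewrite ler_pdivlMr//; lra.
Qed.

End Diophantine.

(** * Weyl differencing and the Weyl inequality *)

Section Weyl.
Variable R : realType.
Implicit Types f : nat -> R.

(** This is [|\sum e^(i f(k))|^2] expanded, with the off-diagonal pairs grouped by index difference
    [h]; each pair occurs in both orders. *)
Lemma sum_sqr_cos f (n : nat) :
  (\sum_(0 <= k < n) cos (f k)) ^+ 2 + (\sum_(0 <= k < n) sin (f k)) ^+ 2 =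
  n%:R + 2 * \sum_(1 <= h < n) \sum_(0 <= k < n - h) cos (f (k + h)%N - f k).
Proof.
elim: n => [|n IH]; first by rewrite !big_geq// expr0n mulr0 !addr0.
have -> : \sum_(1 <= h < n.+1) \sum_(0 <= k < n.+1 - h) cos (f (k + h)%N - f k) =
    \sum_(1 <= h < n) \sum_(0 <= k < n - h) cos (f (k + h)%N - f k) +
    \sum_(0 <= k < n) cos (f n - f k).
  have -> : \sum_(0 <= k < n) cos (f n - f k) =
      \sum_(1 <= h < n.+1) cos (f n - f (n - h)%N).
    by rewrite big_nat_rev/= big_add1.
  have -> : \sum_(1 <= h < n) \sum_(0 <= k < n - h) cos (f (k + h)%N - f k) =
      \sum_(1 <= h < n.+1) \sum_(0 <= k < n - h) cos (f (k + h)%N - f k).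
    have [->|n0] := posnP n; first by rewrite !big_geq.
    by rewrite [RHS]big_nat_recr//= subnn (big_geq (leqnn 0)) addr0.
  rewrite -big_split/=; apply: eq_big_nat => h /andP[h1 hn].
  by rewrite subSn ?big_nat_recr//= subnK.
rewrite !big_nat_recr//= mulrDr addrA -natr1.
have -> : \sum_(0 <= k < n) cos (f n - f k) =
   cos (f n) * \sum_(0 <= k < n) cos (f k) + sin (f n) * \sum_(0 <= k < n) sin (f k).
  by rewrite !mulr_sumr -big_split/=; apply: eq_bigr => k _; rewrite cosB.
have := cos2Dsin2 (f n).
rewrite -[n%:R + 1]addrC -!addrA [n%:R + _]addrA -IH.
have K (A B C D : R) : C ^+ 2 + D ^+ 2 = 1 ->
    (B + C) ^+ 2 + (A + D) ^+ 2 = 1 + (B ^+ 2 + A ^+ 2 + 2 * (C * B + D * A)).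
  move=> E; transitivity (C ^+ 2 + D ^+ 2 + (B ^+ 2 + A ^+ 2 + 2 * (C * B + D * A))).
    by ring.
  by rewrite E.
exact: K.
Qed.

Lemma vdc_ineq f (n : nat) :
  (\sum_(0 <= k < n) cos (f k)) ^+ 2 <=
  n%:R + 2 * \sum_(1 <= h < n) `|\sum_(0 <= k < n - h) cos (f (k + h)%N - f k)|.
Proof.
apply: (@le_trans _ _ ((\sum_(0 <= k < n) cos (f k)) ^+ 2 +
  (\sum_(0 <= k < n) sin (f k)) ^+ 2)); first by rewrite lerDl sqr_ge0.
rewrite sum_sqr_cos lerD2l ler_wpM2l//.
by apply: ler_sum => h _; exact: ler_norm.
Qed.

End Weyl.

Section WeylInequality.
Variable R : realType.
Implicit Types f : nat -> R.

(* [phase d b f]: every [d]-fold iterated difference of [f] with steps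
   [h_1, ..., h_d] is affine with slope [2 pi h_1 ... h_d b]. *)
Fixpoint phase (d : nat) (b : R) f : Prop :=
  if d is d'.+1 then forall h : nat, phase d' (h%:R * b) (fun k => f (k + h)%N - f k)
  else forall k, f k.+1 = f k + 2 * pi * b.

(** Each difference with step [h] lowers the degree by one and multiplies the top coefficient by [h]
    times the degree; these degrees build up the factorial. *)
Lemma phase_poly (d : nat) (p : {poly R}) : (size p <= d.+2)%N ->
  phase d ((d.+1)`!%:R * p`_d.+1) (fun k => 2 * pi * p.[k%:R]).
Proof.
elim: d p => [|d IH] p sp /=.
  move=> k; rewrite mul1r -mulrDr; congr (_ * _).
  have hE (x : R) : p.[x] = p`_0 + p`_1 * x.
    rewrite (@horner_coef_wide _ 2)// !big_ord_recl big_ord0 /= expr0 expr1.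
    by rewrite mulr1 addr0.
  by rewrite !hE -(natr1 k); ring.
move=> h.
(* The Taylor expansion of [p(X + h) - p(X)]. *)
pose q : {poly R} := \sum_(1 <= i < d.+3) (h%:R ^+ i) *: p^`N(i).
have qE k : 2 * pi * p.[(k + h)%N%:R] - 2 * pi * p.[k%:R] = 2 * pi * q.[k%:R] :> R.
  rewrite -mulrBr; congr (_ * _).
  rewrite natrD (@nderiv_taylor_wide _ d.+3)//; last exact: mulrC.
  rewrite -(big_mkord xpredT (fun i => p^`N(i).[k%:R] * h%:R ^+ i)) big_ltn//.
  rewrite nderivn0 expr0 mulr1 addrAC subrr add0r horner_sum.
  by apply: eq_bigr => i _; rewrite hornerZ mulrC.
have p0 i : (d.+3 <= i)%N -> p`_i = 0.
  by move=> hi; rewrite nth_default// (leq_trans sp).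
have sq : (size q <= d.+2)%N.
  apply/leq_sizeP => j hj; rewrite coef_sum big_nat big1// => i /andP[i1 _].
  by rewrite coefZ coef_nderivn p0 ?mul0rn ?mulr0//; lia.
have cq : q`_d.+1 = h%:R * p`_d.+2 *+ d.+2.
  rewrite coef_sum big_ltn// big_nat big1 ?addr0 => [|i /andP[i1 _]]; last first.
    by rewrite coefZ coef_nderivn p0 ?mul0rn ?mulr0//; lia.
  by rewrite coefZ coef_nderivn add1n bin1 expr1 mulrnAr.
have := IH q sq; rewrite cq (_ : (d.+1)`!%:R * _ = h%:R * ((d.+2)`!%:R * p`_d.+2)).
  by congr (phase _ _ _); apply/funext => k; rewrite qE.
by rewrite [(d.+2)`!]factS natrM -[in LHS]mulr_natr; ring.
Qed.

(** If [s] is the distance from [b] to the nearest integer, Kusmin-Landau bounds the sum by [2 / s],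
    so [s <= 2 K / n <= K^2 / n]. *)
Lemma weyl_linear (b : R) f (n K : nat) : phase 0 b f -> (0 < n)%N -> (2 <= K)%N ->
  n%:R / K%:R <= `|\sum_(0 <= k < n) cos (f k)| ->
  near_int b (K%:R ^+ 2 / n%:R).
Proof.
move=> /= Hf n0 K2 Hs.
have n0' : 0 < n%:R :> R by rewrite ltr0n.
have K2' : 2 <= K%:R :> R by rewrite ler_nat.
have /andP[l1 l2] := floor_itv b; rewrite intrD in l2; set l := Num.floor b in l1 l2.
pose t := b - l%:~R; pose s : R := Num.min t (1 - t).
have rhs0 : 0 <= K%:R ^+ 2 / n%:R :> R by rewrite divr_ge0// exprn_ge0.
have [s0|s0] := leP s 0.
  exists l; move: s0; rewrite /s /t ge_min => /orP[] h; last lra.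
  have -> : b - l%:~R = 0 by apply/eqP; rewrite eq_le h; lra.
  by rewrite normr0.
have pi2 := @pi_ge2 R.
have [st s1t] : s <= t /\ s <= 1 - t by rewrite /s !ge_min !lexx orbT.
have pis0 : 0 < pi * s by rewrite mulr_gt0// pi_gt0.
have KL : `|\sum_(0 <= k < n) cos (f k)| <= 1 + 6 / (2 * pi * s).
  have pt : pi * s <= pi * t by rewrite ler_wpM2l// pi_ge0.
  have p1t : pi * s <= pi * (1 - t) by rewrite ler_wpM2l// pi_ge0.
  apply: (@kusmin_landau _ _ _ _ _ l); [lra|lra| |] => k; last first.
    by rewrite !Hf => _ _; lra.
  by rewrite Hf => _; rewrite /t in pt p1t *; lra.
have sle : s <= K%:R ^+ 2 / n%:R.
  have h1 : 6 / (2 * pi * s) <= 3 / 2 / s.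
    rewrite ler_pdivrMr; last lra.
    have -> : 3 / 2 / s * (2 * pi * s) = 3 * pi by field; rewrite gt_eqF.
    lra.
  have h2 : 1 <= 1 / 2 / s by rewrite ler_pdivlMr//; lra.
  have h3 : n%:R / K%:R <= 2 / s :> R by lra.
  move: h3; rewrite ler_pdivlMr// mulrAC ler_pdivrMr; last lra.
  rewrite ler_pdivlMr// expr2 => h3.
  have : 2 * K%:R <= K%:R * K%:R :> R by rewrite ler_wpM2r//; lra.
  lra.
have : s = t \/ s = 1 - t by rewrite /s; case: leP; [left|right].
move=> [] sE.
  exists l; rewrite -/t -sE ger0_norm// ltW//.
exists (l + 1); rewrite intrD opprD addrA -/t -normrN ger0_norm; lra.
Qed.

Lemma near_int_big (y e : R) : 1 <= e -> near_int y e.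
Proof.
move=> e1; exists (Num.floor y); have /andP[l1 l2] := floor_itv y.
by rewrite intrD in l2; rewrite ger0_norm; lra.
Qed.

(** The hypotheses give [\sum G h >= n^2 / (4 K^2)], and the steps with [G h < n / K^5] account for
    at most half of it. The exponent 5 is chosen so that [8 K^2 <= K^5]. *)
Lemma weyl_step_count f (n K : nat) (G : nat -> R) :
  (0 < n)%N -> (2 <= K)%N -> (2 * K ^ 2 <= n)%N ->
  (forall h, 0 <= G h <= n%:R) ->
  n%:R / K%:R <= `|\sum_(0 <= k < n) cos (f k)| ->
  (\sum_(0 <= k < n) cos (f k)) ^+ 2 <= n%:R + 2 * \sum_(1 <= h < n) G h ->
  (n <= #|[set h : 'I_n | (0 < h)%N && (n%:R / K%:R ^+ 5 <= G h)%R]| * K ^ 5)%N.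
Proof.
move=> n0 K2 nK HG Hs Hv; set H := [set h : 'I_n | _].
have n0' : 0 < n%:R :> R by rewrite ltr0n.
have K2' : 2 <= K%:R :> R by rewrite ler_nat.
have K0 : 0 < K%:R :> R by lra.
have K5 : 0 < K%:R ^+ 5 :> R by rewrite exprn_gt0.
have HS : \sum_(1 <= h < n) G h <= #|H|%:R * n%:R + n%:R * (n%:R / K%:R ^+ 5).
  apply: (@le_trans _ _ (\sum_(h < n) ((h \in H)%:R * n%:R + n%:R / K%:R ^+ 5))).
    rewrite big_geq_mkord big_mkcond/=; apply: ler_sum => i _; rewrite inE /=.
    have /andP[g0 g1] := HG i.
    have Y0 : 0 <= n%:R / K%:R ^+ 5 :> R by rewrite divr_ge0// ltW.
    case: ifPn => /= i0; last by rewrite mul0r add0r.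
    have [h|h] := leP (n%:R / K%:R ^+ 5) (G i).
      by rewrite mul1r; apply: (le_trans g1); rewrite lerDl.
    by rewrite mul0r add0r ltW.
  rewrite big_split/= sumr_const card_ord -mulr_suml -natr_sum.
  rewrite -(big_mkcond (fun h => h \in H) (fun=> 1%N))/= sum1_card.
  by rewrite [n%:R * (n%:R / _)]mulr_natl.
have S2 : (n%:R / K%:R) ^+ 2 <= (\sum_(0 <= k < n) cos (f k)) ^+ 2 :> R.
  by rewrite -[leRHS]real_normK ?num_real// ler_sqr ?nnegrE ?divr_ge0// ltW.
have nK' : 2 * K%:R ^+ 2 <= n%:R :> R by rewrite -natrX -natrM ler_nat.
rewrite -(ler_nat R) natrM natrX -ler_pdivrMr//.
have K58 : 8 * K%:R ^+ 2 <= K%:R ^+ 5 :> R.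
  rewrite (exprD _ 3 2) ler_wpM2r ?sqr_ge0//.
  have -> : 8 = 2 ^+ 3 :> R by ring.
  by rewrite lerXn2r ?nnegrE// ltW.
set X := #|H|%:R in HS *; set Y := n%:R / K%:R ^+ 5 in HS *.
have E1 : (n%:R / K%:R) ^+ 2 = n%:R * (n%:R / K%:R ^+ 2) :> R by field; rewrite gt_eqF.
have K2p : 0 < K%:R ^+ 2 :> R by rewrite exprn_gt0.
have H1 : n%:R * 2 <= n%:R * (n%:R / K%:R ^+ 2) :> R.
  by rewrite ler_pM2l// ler_pdivlMr.
have H2 : Y <= n%:R / K%:R ^+ 2 / 8.
  rewrite /Y -mulrA ler_pM2l// -invfM lef_pV2 ?posrE//; first by rewrite mulrC.
  by rewrite mulr_gt0.
rewrite -(ler_pM2l n0').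
have H3 : n%:R * Y <= n%:R * (n%:R / K%:R ^+ 2 / 8) by rewrite ler_pM2l.
lra.
Qed.

(** In [weyl], [q] is the denominator found for the step [h]; a single denominator must serve a
    proportion [1 / L] of all steps. *)
Lemma pigeonhole_cover (n Q L : nat) (A : nat -> {set 'I_n}) (H : {set 'I_n}) :
  (0 < Q)%N -> (0 < n)%N -> (n * Q <= #|H| * L)%N ->
  (forall h, h \in H -> exists2 q, (0 < q <= Q)%N & h \in A q) ->
  exists2 q, (0 < q <= Q)%N & (n <= #|A q| * L)%N.
Proof.
move=> Q0 n0 HL HA; apply: contrapT => no.
have lt q : (0 < q <= Q)%N -> (#|A q| * L < n)%N.
  by move=> qQ; rewrite ltnNge; apply/negP => le; apply: no; exists q.
have HS : (#|H| <= \sum_(1 <= q < Q.+1) #|A q|)%N.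
  have -> : (\sum_(1 <= q < Q.+1) #|A q| = \sum_(h : 'I_n) \sum_(1 <= q < Q.+1) (h \in A q))%N.
    rewrite exchange_big/=; apply: eq_bigr => q _.
    by rewrite -sum1_card big_mkcond.
  rewrite -sum1_card [leqLHS]big_mkcond/=; apply: leq_sum => h _.
  case: ifPn => // /HA[q qQ hq].
  rewrite (bigD1_seq q)//= ?mem_index_iota ?iota_uniq// ?hq//.
have : (#|H| * L <= \sum_(1 <= q < Q.+1) #|A q| * L)%N.
  by rewrite -big_distrl/= leq_mul2r HS orbT.
have : (\sum_(1 <= q < Q.+1) #|A q| * L <= \sum_(1 <= q < Q.+1) n.-1)%N.
  rewrite [leqLHS]big_nat [leqRHS]big_nat; apply: leq_sum => q qQ.
  by rewrite -ltnS prednK//; exact: lt.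
rewrite sum_nat_const_nat subn1/= => h1 h2.
have := leq_trans HL (leq_trans h2 h1).
by rewrite mulnC leq_mul2l; lia.
Qed.


(* Induction on the degree. Differencing yields many [h] for which some
   [q_h h b] is nearly an integer; a pigeonhole argument makes [q_h] constant, and
   [vinogradov] applied to [q b] merges these into one sharper approximation. *)
Lemma weyl (d : nat) : exists C : nat, forall (b : R) f (n K : nat),
  phase d b f -> (0 < n)%N -> (2 <= K)%N ->
  n%:R / K%:R <= `|\sum_(0 <= k < n) cos (f k)| ->
  exists2 q : nat, (0 < q <= K ^ C)%N &
    near_int (q%:R * b) (K%:R ^+ C / n%:R ^+ d.+1).
Proof.
elim: d => [|d [C IH]].
  exists 2%N => b f n K Hf n0 K2 Hs; exists 1%N; first by rewrite /= expn_gt0; lia.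
  by rewrite mul1r expr1; exact: weyl_linear Hs.
(* The 5 comes from [K1 = K ^ 5]; [K1 ^ (2 C + d + 3) < n] ensures the size conditions of
   [vinogradov]. *)
pose P := (5 * (2 * C + d + 3))%N.
exists (P * d.+2)%N => b f n K Hf n0 K2 Hs.
have K0 : (0 < K)%N by lia.
have n0' : 0 < n%:R :> R by rewrite ltr0n.
have Kx m : (0 < K ^ m)%N by rewrite expn_gt0 K0.
have Kx' m : 0 < K%:R ^+ m :> R by rewrite exprn_gt0// ltr0n.
have Kle m m' : (m <= m')%N -> (K ^ m <= K ^ m')%N by move=> h; rewrite leq_exp2l.
(* For small [n] the allowed error is at least 1, and every real is that close to an integer. *)
have [nP|Pn] := leqP n (K ^ P).
  exists 1%N; first by rewrite Kx.
  apply: near_int_big; rewrite ler_pdivlMr ?exprn_gt0// mul1r exprM.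
  by rewrite lerXn2r ?nnegrE ?exprn_ge0// -natrX ler_nat.
set S := \sum_(0 <= k < n) _ in Hs.
pose g h k := f (k + h)%N - f k.
pose G h := `|\sum_(0 <= k < n - h) cos (g h k)|.
have Gle h : G h <= (n - h)%:R.
  by rewrite /G (le_trans (norm_sum_cos_le _ _ _))// subn0.
have HG h : 0 <= G h <= n%:R.
  by rewrite normr_ge0 (le_trans (Gle h))// ler_nat leq_subr.
pose K1 := (K ^ 5)%N; have K12 : (32 <= K1)%N by rewrite (@leq_exp2r 2 K 5).
have K1R : K1%:R = K%:R ^+ 5 :> R by rewrite natrX.
have K10 : (0 < K1)%N by lia.
have K1x m : 0 < K1%:R ^+ m :> R by rewrite exprn_gt0// ltr0n.
have K1le m m' : (m <= m')%N -> (K1 ^ m <= K1 ^ m')%N by move=> h; rewrite leq_exp2l//; lia.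
have K1leR m m' : (m <= m')%N -> K1%:R ^+ m <= K1%:R ^+ m' :> R.
  by move=> h; rewrite -!natrX ler_nat K1le.
have PK1 : (K1 ^ (2 * C + d + 3) < n)%N by rewrite /K1 -expnM.
have K1n m : (m <= 2 * C + d + 3)%N -> (K1 ^ m <= n)%N.
  by move=> /K1le h; apply: leq_trans h (ltnW PK1).
have nK2 : (2 * K ^ 2 <= n)%N.
  apply: leq_trans (K1n 1%N _); last lia.
  rewrite expn1 (@leq_trans (K ^ 3))//; last exact: Kle.
  by rewrite [leqRHS]expnS leq_mul2r K2 orbT.
have hcount := weyl_step_count n0 K2 nK2 HG Hs (vdc_ineq f n).
rewrite -/K1 in hcount; set H := [set h : 'I_n | _] in hcount.
(* A large differenced sum has length [n - h >= n / K1]; replacing [n - h] by [n] in the inductive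
   error costs [K1 ^ (d + 1)]. *)
pose e : R := K1%:R ^+ (C + d.+1) / n%:R ^+ d.+1.
pose A q : {set 'I_n} := [set h : 'I_n | `[< near_int (h%:R * (q%:R * b)) e >]].
pose L := (K1 ^ C.+1)%N.
have [|||q qQ Aq] := @pigeonhole_cover n (K1 ^ C) L A H _ n0.
- by rewrite expn_gt0 K10.
- by rewrite /L expnS mulnA leq_mul2r hcount orbT.
- move=> h; rewrite inE => /andP[h0 hG].
  have nh : n%:R / K1%:R <= (n - h)%:R :> R.
    by rewrite K1R; apply: le_trans hG (Gle h).
  have nh0 : (0 < n - h)%N by rewrite subn_gt0.
  have [||q qQ hq] := IH (h%:R * b) (g h) (n - h)%N K1 (Hf h) nh0.
  + by lia.
  + rewrite -/(G h); apply: le_trans hG; rewrite -K1R.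
    by rewrite ler_wpM2r ?invr_ge0// ler_nat leq_subr.
  exists q => //; rewrite inE; apply/asboolP.
  rewrite mulrCA; apply: near_int_le hq.
  rewrite /e exprD -mulrA ler_pM2l// -exprVn -expr_div_n.
  rewrite lerXn2r ?nnegrE ?invr_ge0 ?divr_ge0// -[leRHS]invrK invf_div.
  by rewrite lef_pV2 ?posrE ?divr_gt0 ?ltr0n.
have LR : L%:R = K1%:R ^+ C.+1 :> R by rewrite natrX.
have [|||||q0 q0L hq0] := @vinogradov R (q%:R * b) e n L (A q) _ Aq.
- by rewrite expn_gt0 K10.
- by move=> h; rewrite inE => /asboolP.
- by rewrite divr_ge0 ?exprn_ge0.
- rewrite /e mulrA ler_pdivrMr ?exprn_gt0// mul1r LR -mulrA -exprD.
  apply: (@le_trans _ _ (K1%:R ^+ (2 * C + d + 3))).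
    apply: (@le_trans _ _ (K1%:R * K1%:R ^+ (C.+1 + (C + d.+1)))).
      by rewrite ler_wpM2r ?exprn_ge0// ler_nat.
    by rewrite -exprS K1leR//; lia.
  rewrite -!natrX ler_nat; apply: leq_trans (ltnW PK1) _.
  by rewrite [leqRHS]expnS leq_pmulr// expn_gt0 n0.
- apply: leq_trans (K1n (2 * C.+1 + 1)%N _); last lia.
  rewrite /L -expnM addn1 [(2 * C.+1)%N]mulnC [leqRHS]expnS leq_mul2r.
  by apply/orP; right; apply: leq_trans K12.
have bnd m : (m <= (2 * C + d + 3) * d.+2)%N -> (K1 ^ m <= K ^ (P * d.+2))%N.
  by move=> h; rewrite /K1 -expnM Kle// /P -mulnA leq_mul2l.
exists (q0 * q)%N.
  have /andP[q1 q2] := qQ; have /andP[q3 q4] := q0L.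
  rewrite muln_gt0 q1 q3/=; apply: leq_trans (bnd (2 * C + 2)%N _); last nia.
  apply: (@leq_trans (2 * L * K1 ^ C)); first exact: leq_mul.
  rewrite /L (_ : (2 * C + 2)%N = (1 + C.+1 + C)%N); last lia.
  by rewrite !expnD leq_mul2r leq_mul2r expn1; apply/orP; right; apply/orP; right; lia.
rewrite natrM -mulrA; apply: near_int_le hq0.
rewrite /e LR -exprM [leLHS](_ : _ = 16 * (K1%:R ^+ (C + d.+1) * K1%:R ^+ (C.+1 * 2)) / n%:R ^+ d.+2); last first.
  by rewrite [n%:R ^+ d.+2]exprS; field; rewrite !gt_eqF// exprn_gt0.
rewrite ler_wpM2r ?invr_ge0 ?exprn_ge0// -exprD.
apply: (@le_trans _ _ (K1%:R * K1%:R ^+ (C + d.+1 + C.+1 * 2))).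
  by rewrite ler_wpM2r ?exprn_ge0// ler_nat; lia.
by rewrite -exprS -!natrX ler_nat bnd//; nia.
Qed.

End WeylInequality.

(** * Summation over the dyadic scales *)

Section Summation.
Variable R : realType.

Lemma sum_geo_le (r : R) (J : nat) : 0 <= r -> r < 1 ->
  \sum_(j < J) r ^+ j <= (1 - r)^-1.
Proof.
move=> r0 r1; rewrite -[leRHS]mul1r ler_pdivlMr; last lra.
have -> : (\sum_(j < J) r ^+ j) * (1 - r) = 1 - r ^+ J.
  by rewrite -opprB mulrN mulrC -subrX1; ring.
by rewrite lerBlDr lerDl exprn_ge0.
Qed.

(** Normalized size of a sum with total phase [w]: the trivial bound for small [w], Kusmin-Landau
    for large [w]. The convention [0^-1 = 0] gives [peak 0 = 0]. *)
Definition peak (w : R) : R := Num.min w w^-1.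

Lemma peak_ge0 (w : R) : 0 <= w -> 0 <= peak w.
Proof. by move=> w0; rewrite /peak le_min w0 invr_ge0. Qed.

Lemma peak_le1 (w : R) : 0 <= w -> peak w <= 1.
Proof.
move=> w0; rewrite /peak ge_min; have [//|w1] := leP w 1.
by rewrite orFb invf_le1 ?ltW//; lra.
Qed.

Lemma sum_peak_le (v t : R) (J : nat) : 0 <= v -> 1 < t ->
  \sum_(j < J) peak (v * t ^+ j) <= 2 * t / (t - 1).
Proof.
move=> v0 t1; have t0 : 0 < t - 1 by lra.
have B0 : 0 <= 2 * t / (t - 1) by rewrite divr_ge0//; lra.
move: v0; rewrite le_eqVlt => /orP[/eqP<-|v0].
  by rewrite big1// => j _; rewrite mul0r /peak invr0 minxx.
(* An invariant for the induction: before the peak, the geometric sum of all smaller terms; after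
   it, the final bound minus the tail still to come. *)
suff : \sum_(j < J) peak (v * t ^+ j) <=
    if v * t ^+ J <= 1 then v * t ^+ J / (t - 1)
    else 2 * t / (t - 1) - t / (t - 1) / (v * t ^+ J).
  have w0 : 0 < v * t ^+ J by rewrite mulr_gt0// exprn_gt0//; lra.
  case: ifPn => [w1|w1] h; apply: (le_trans h).
    by rewrite ler_wpM2r ?invr_ge0 ?ltW//; lra.
  by rewrite lerBlDr lerDl !divr_ge0// ltW//; lra.
elim: J => [|J IH].
  rewrite big_ord0 expr0 mulr1; case: ifPn => [_|]; first by rewrite divr_ge0// ltW.
  rewrite -ltNge => v1; rewrite subr_ge0 ler_pdivrMr//.
  rewrite mulrAC ler_pM2r ?invr_gt0//.
  have : t * 1 <= t * v by rewrite ler_pM2l; lra.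
  have : 0 <= t * v by rewrite mulr_ge0; lra.
  lra.
rewrite big_ord_recr/=; have w0 : 0 < v * t ^+ J by rewrite mulr_gt0// exprn_gt0//; lra.
have -> : v * t ^+ J.+1 = t * (v * t ^+ J) by rewrite exprS; ring.
move: (v * t ^+ J) w0 IH => w w0 IH.
have [w1|w1] := leP w 1.
  rewrite w1 in IH.
  have E : w / (t - 1) + w = t * w / (t - 1) by field; rewrite gt_eqF.
  apply: (@le_trans _ _ (t * w / (t - 1))).
    by rewrite -E lerD// /peak ge_min lexx.
  case: ifPn => // ; rewrite -ltNge => tw1.
  have tw0 : 0 < t * w by lra.
  rewrite -(ler_pM2r t0) mulrBl.
  have -> : t * w / (t - 1) * (t - 1) = t * w by field; rewrite gt_eqF.
  have -> : 2 * t / (t - 1) * (t - 1) = 2 * t by field; rewrite gt_eqF.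
  have -> : t / (t - 1) / (t * w) * (t - 1) = w^-1 by field; rewrite !gt_eqF//; lra.
  have : w^-1 <= t by rewrite -[w^-1]mul1r ler_pdivrMr// ltW.
  have : t * w <= t * 1 by rewrite ler_pM2l//; lra.
  lra.
rewrite (lt_geF w1) in IH.
have tw1 : 1 < t * w.
  have : 1 * 1 < t * w by rewrite ltr_pM//; lra.
  lra.
rewrite (lt_geF tw1).
apply: (le_trans (lerD IH (_ : _ <= w^-1))); first by rewrite /peak ge_min lexx orbT.
have -> : t / (t - 1) / (t * w) = (t - 1)^-1 / w by field; rewrite !gt_eqF//; lra.
have -> : t / (t - 1) / w = (t - 1)^-1 / w + w^-1 by field; rewrite !gt_eqF//; lra.
lra.
Qed.

Lemma last_index (P : pred nat) (J : nat) :
  (forall i, (i < J)%N -> ~~ P i) \/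
  exists i, [/\ (i < J)%N, P i & forall i', (i < i' < J)%N -> ~~ P i'].
Proof.
elim: J => [|J IH]; first by left.
have [PJ|PJ] := boolP (P J).
  right; exists J; split => // i'; lia.
case: IH => [h|[i [iJ Pi h]]]; [left|right].
  by move=> i; rewrite ltnS leq_eqVlt => /orP[/eqP->//|]; exact: h.
exists i; split => //; first lia.
by move=> i' /andP[ii]; rewrite ltnS leq_eqVlt => /orP[/eqP->//|iJ']; apply: h; rewrite ii.
Qed.

(* The scales [j] are split into classes according to the value [b j] (in the
   application, the rational approximating [theta]). Within a class the bound
   is a two-sided geometric series, and a class entered after scale [m] gains
   the factor [rho ^+ m]. *)
Lemma class_sum (phi b : nat -> R) (maj : pred nat) (A rho t theta : R) :
  0 <= A -> 0 <= rho -> rho < 1 -> 1 < t ->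
  (forall j, 0 <= phi j) ->
  (forall j, ~~ maj j -> phi j <= A * rho ^+ j) ->
  (forall j, maj j -> phi j <=
     A * (peak (Num.sqrt `|theta - b j| * t ^+ j) ^+ 2 + rho ^+ (2 * j))) ->
  (forall m j, maj m -> maj j -> (m < j)%N -> b m != b j ->
     phi j <= A * rho ^+ (2 * m)) ->
  forall J : nat, \sum_(j < J) phi j <=
    A * ((1 - rho)^-1 + (2 * t / (t - 1) + (1 - rho)^-1) * (1 + (1 - rho)^-1)).
Proof.
move=> A0 r0 r1 t1 H1 H2 H3 H4 J.
set C0 := 2 * t / (t - 1) + (1 - rho)^-1.
pose M be j := peak (Num.sqrt `|theta - be| * t ^+ j).
have t0 : 0 < t by lra.
have w0 be j : 0 <= Num.sqrt `|theta - be| * t ^+ j.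
  by rewrite mulr_ge0 ?sqrtr_ge0// exprn_ge0// ltW.
have M0 be j : 0 <= M be j by exact: peak_ge0.
have M1 be j : M be j <= 1 by exact: peak_le1.
have geo n : \sum_(j < n) rho ^+ j <= (1 - rho)^-1 by exact: sum_geo_le.
have C00 : 0 <= C0.
  by rewrite addr_ge0 ?divr_ge0 ?invr_ge0; lra.
have sumM be n : \sum_(j < n) (M be j + rho ^+ j) <= C0.
  rewrite /C0 big_split/=; apply: lerD; [|exact: geo].
  exact: (sum_peak_le n (sqrtr_ge0 `|theta - be|) t1).
have rj0 j : 0 <= rho ^+ j by exact: exprn_ge0.
have rj1 j : rho ^+ j <= 1 by rewrite exprn_ile1// ltW.
have sq1 (x : R) : 0 <= x -> x <= 1 -> x ^+ 2 <= x.
  by move=> x0 x1; rewrite expr2 -[leRHS]mulr1 ler_wpM2l.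
have maj1 j : maj j -> phi j <= A * (M (b j) j + rho ^+ j).
  move=> /H3 h; apply: (le_trans h); rewrite ler_wpM2l// mulnC exprM lerD//.
    exact: (sq1 _ (M0 (b j) j) (M1 (b j) j)).
  exact: (sq1 _ (rj0 j) (rj1 j)).
(* Geometric mean of the two bounds: [rho ^ m] is kept for the sum over classes, and the other
   factor still sums within a class. This is why the hypotheses carry squares. *)
have maj2 m j : maj m -> maj j -> (m < j)%N -> b m != b j ->
    phi j <= A * rho ^+ m * (M (b j) j + rho ^+ j).
  move=> mm mj lt ne; have h1 := H3 _ mj; have h2 := H4 _ _ mm mj lt ne.
  rewrite -(@ler_sqr _ (phi j)) ?nnegrE//; last first.
    by rewrite !mulr_ge0// addr_ge0.
  apply: (le_trans (ler_pM (H1 j) (H1 j) h2 h1)).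
  rewrite -/(M _ _) mulnC exprM [(2 * j)%N]mulnC exprM.
  set x := M _ _; set y := rho ^+ j; set z := rho ^+ m.
  have xy : 0 <= x * y by apply: mulr_ge0; [exact: M0|exact: rj0].
  have : 0 <= (A * z) ^+ 2 * (x * y) by rewrite mulr_ge0 ?sqr_ge0.
  lra.
pose S n := \sum_(j < n | maj j) phi j.
(* Strong induction on the last major scale [i] whose class differs from that of [n]: all later
   major scales share the class of [n] and together cost [A rho^i C0]. The leading 1 pays for the
   first class, which has no gain. *)
have SP n : S n.+1 <= A * C0 * (1 + \sum_(i < n) rho ^+ i).
  elim/ltn_ind: n => n IH; rewrite /S.
  have g0 k : 0 <= \sum_(i < k) rho ^+ i :> R by rewrite sumr_ge0.
  rewrite big_mkcond big_ord_recr/= -big_mkcond/=.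
  have [mn|mn] := boolP (maj n); last first.
    rewrite addr0; case: n IH mn => [|n] IH mn.
      by rewrite !big_ord0 addr0 mulr1 mulr_ge0.
    apply: (le_trans (IH n (ltnSn n))).
    by rewrite ler_wpM2l ?mulr_ge0// big_ord_recr/= lerD2l lerDl.
  have bnd (c : R) (i : nat) : 0 <= c ->
      (forall j, (i <= j <= n)%N -> maj j -> phi j <= c * (M (b n) j + rho ^+ j)) ->
      \sum_(i <= j < n.+1 | maj j) phi j <= c * C0.
    move=> c0 h; apply: (@le_trans _ _ (\sum_(i <= j < n.+1) c * (M (b n) j + rho ^+ j))).
      rewrite big_mkcond [leLHS]big_nat [leRHS]big_nat; apply: ler_sum => j hj.
      by case: ifPn => mj; [apply: h => //; lia|rewrite mulr_ge0// addr_ge0].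
    rewrite -mulr_sumr ler_wpM2l//; apply: le_trans (sumM (b n) n.+1).
    rewrite big_geq_mkord big_mkcond; apply: ler_sum => j _.
    by case: ifP => // _; rewrite addr_ge0.
  have -> : \sum_(j < n | maj j) phi j + phi n = \sum_(0 <= j < n.+1 | maj j) phi j.
    by rewrite big_mkcond [RHS]big_mkcond big_nat_recr//= mn big_mkord.
  case: (last_index (fun i => maj i && (b i != b n)) n) => [none|[i [ilt /andP[mi bi] last]]].
    apply: (@le_trans _ _ (A * C0)).
      apply: bnd => // j /andP[_ jn] mj.
      move: jn; rewrite leq_eqVlt => /orP[/eqP->|jn]; first exact: maj1.
      have := none j jn; rewrite mj negbK => /eqP <-; exact: maj1.
    by apply: ler_peMr; [exact: mulr_ge0|rewrite lerDl; exact: g0].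
  rewrite (@big_cat_nat _ _ _ i.+1)//=; last lia.
  apply: (@le_trans _ _ (A * C0 * (1 + \sum_(i' < i) rho ^+ i') + A * rho ^+ i * C0)).
    apply: lerD; first by have := IH i ilt; rewrite /S -(big_mkord maj).
    apply: bnd => //; first exact: mulr_ge0.
    move=> j /andP[ij jn] mj.
    have bj : b j = b n.
      move: jn; rewrite leq_eqVlt => /orP[/eqP->//|jn].
      by have := last j; rewrite ij jn mj negbK => /(_ isT)/eqP.
    by rewrite -bj; apply: maj2 => //; rewrite bj.
  have : \sum_(i' < i) rho ^+ i' + rho ^+ i <= \sum_(i' < n) rho ^+ i'.
    rewrite -!(big_mkord xpredT (fun k => rho ^+ k)).
    by rewrite [leRHS](@big_cat_nat _ _ _ i.+1)//= [X in _ <= X + _]big_nat_recr//= lerDl sumr_ge0.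
  move=> h; have := ler_wpM2l (mulr_ge0 A0 C00) h; lra.
have : \sum_(j < J) phi j <= \sum_(j < J) A * rho ^+ j + S J.
  rewrite /S [X in _ + X]big_mkcond -big_split/=; apply: ler_sum => j _.
  by case: ifPn => [mj|/H2 h]; rewrite ?addr0// lerDr mulr_ge0.
have SJ : S J <= A * C0 * (1 + (1 - rho)^-1).
  apply: (@le_trans _ _ (S J.+1)).
    by rewrite /S ![leLHS]big_mkcond ![leRHS]big_mkcond big_ord_recr/= lerDl; case: ifP.
  by apply: (le_trans (SP _)); rewrite ler_wpM2l ?mulr_ge0// lerD2l.
rewrite -mulr_sumr; have := ler_wpM2l A0 (geo J); lra.
Qed.

End Summation.

(** * Odd powers *)

Section MajorArc.
Variable R : realType.
Implicit Types (x y : R) (h : nat -> R).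

Lemma norm_cosB_le x y : `|cos x - cos y| <= `|x - y|.
Proof.
have -> : cos x - cos y = - (2 * (sin ((x + y) / 2) * sin ((x - y) / 2))).
  have -> : cos x = cos ((x + y) / 2 + (x - y) / 2) by congr cos; field.
  have -> : cos y = cos ((x + y) / 2 - (x - y) / 2) by congr cos; field.
  by rewrite cosD cosB; ring.
rewrite normrN normrM ger0_norm// normrM.
have -> : `|x - y| = 2 * (1 * `|(x - y) / 2|).
  by rewrite mul1r normrM [`|2^-1|]ger0_norm ?invr_ge0//; field.
by rewrite ler_wpM2l// ler_pM// ?sin_max// norm_sin_le.
Qed.

Lemma norm_sinB_le x y : `|sin x - sin y| <= `|x - y|.
Proof.
rewrite -!cosBpihalf; apply: (le_trans (norm_cosB_le _ _)).
by rewrite opprB addrA subrK.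
Qed.

(** Complete periods cancel, leaving fewer than [q] terms. *)
Lemma periodic_sum_le h (q M m : nat) (B : R) : (0 < q)%N -> (M <= m)%N ->
  (forall k, h (k + q)%N = h k) -> (forall k, `|h k| <= B) ->
  \sum_(0 <= k < q) h k = 0 -> `|\sum_(M <= k < m) h k| <= B * q%:R.
Proof.
move=> q0 Mm hq hB h0.
have B0 : 0 <= B by apply: le_trans (hB 0%N).
have win N : \sum_(N <= k < N + q) h k = 0.
  elim: N => [|N IH]; first by rewrite add0n.
  rewrite addSn big_nat_recr/=; last by rewrite -addn1 leq_add2l.
  have lt : (N < N + q)%N by rewrite -addn1 leq_add2l.
  by move: IH; rewrite (big_ltn lt) hq addrC.
have wins s : \sum_(M <= k < M + s * q) h k = 0.
  elim: s => [|s IH]; first by rewrite mul0n addn0 big_geq.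
  rewrite mulSn addnA [(M + q)%N]addnC -addnA addnC.
  by rewrite (@big_cat_nat _ _ _ (M + s * q))/= ?leq_addr// IH add0r win.
have d := divn_eq (m - M) q; set s := ((m - M) %/ q)%N in d.
have r := ltn_pmod (m - M) q0.
have Ms : (M + s * q <= m)%N.
  by rewrite -(subnKC Mm) leq_add2l d leq_addr.
rewrite (@big_cat_nat _ _ _ (M + s * q))/= ?leq_addr// wins add0r.
apply: (le_trans (ler_norm_sum _ _ _)).
apply: (@le_trans _ _ (\sum_(M + s * q <= k < m) B)); first exact: ler_sum.
rewrite sumr_const_nat -[leLHS]mulr_natr ler_wpM2l// ler_nat.
by rewrite subnDA d addKn ltnW.
Qed.

Variables (p : int) (q a : nat).
Hypotheses (q0 : (0 < q)%N) (a_odd : odd a).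

Definition ratphase (z : int) : R := 2 * pi * (p * z)%:~R / q%:R.

Lemma ratphaseD (z m : int) : ratphase (z + q%:Z * m) = ratphase z + 2 * pi * (p * m)%:~R.
Proof.
rewrite /ratphase !intrM intrD intrM -pmulrn; field.
by rewrite pnatr_eq0 -lt0n.
Qed.

Let cs (k : nat) : R := cos (ratphase (k%:Z ^+ a)).
Let sn (k : nat) : R := sin (ratphase (k%:Z ^+ a)).

Let addq k : exists m, (k + q)%N%:Z ^+ a = k%:Z ^+ a + q%:Z * m.
Proof.
eexists; apply/eqP; rewrite addrC -subr_eq; apply/eqP.
by rewrite subrXX PoszD [X in X * _]addrAC subrr add0r.
Qed.

Let subq k : (k <= q)%N -> exists m, (q - k)%N%:Z ^+ a = - k%:Z ^+ a + q%:Z * m.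
Proof.
move=> kq; eexists; apply/eqP; rewrite addrC -subr_eq.
have -> : - k%:Z ^+ a = (- k%:Z) ^+ a.
  by rewrite [RHS]exprNn -signr_odd a_odd expr1 mulN1r.
by rewrite subrXX -subzn// opprK subrK.
Qed.

Let cs_per k : cs (k + q)%N = cs k.
Proof. by have [m E] := addq k; rewrite /cs E ratphaseD cosD2pi_int. Qed.

Let sn_per k : sn (k + q)%N = sn k.
Proof. by have [m E] := addq k; rewrite /sn E ratphaseD sinD2pi_int. Qed.

(* This is where the parity of [a] enters: [k |-> q - k] changes the sign of
   [k ^ a] modulo [q], so the complete Gauss sum is real. *)
Let sn_sum0 : \sum_(0 <= k < q) sn k = 0.
Proof.
rewrite big_ltn//.
have a0 : (0 < a)%N by case: a a_odd.
have -> : sn 0%N = 0.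
  by rewrite /sn expr0n gtn_eqF//= /ratphase mulr0 mulr0 mul0r sin0.
rewrite add0r; set S := \sum_(1 <= k < q) sn k.
suff : S = - S by move=> h; lra.
rewrite /S [LHS]big_nat_rev/= -sumrN; apply: eq_big_nat => k /andP[k1 kq].
rewrite add1n subSS.
have [m E] := subq (ltnW kq).
rewrite /sn E ratphaseD sinD2pi_int /ratphase.
by rewrite mulrN intrN mulrN mulNr sinN.
Qed.

(** The smallness of [b] keeps every phase increment in the block below [pi], so Kusmin-Landau
    applies without crossing a multiple of [2 pi]. *)
Lemma monomial_main_sum (b : R) (N n : nat) : (0 < N)%N ->
  (N <= n <= 2 * N)%N -> 2 * a%:R * (2 * N%:R) ^+ a.-1 * `|b| <= 1 ->
  `|\sum_(N <= k < n) sin (2 * pi * b * k%:R ^+ a)| <=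
    8 * 2 ^+ a * (N%:R * peak (`|b| * N%:R ^+ a) + 1).
Proof.
move=> N0 /andP[Nn nN] small.
have a0 : (0 < a)%N by case: a a_odd.
wlog b0 : b small / 0 <= b.
  move=> H; have [|b0] := leP 0 b; first exact: H.
  have := H (- b); rewrite normrN oppr_ge0 => /(_ small (ltW b0)).
  have -> : \sum_(N <= k < n) sin (2 * pi * b * k%:R ^+ a) =
      - \sum_(N <= k < n) sin (2 * pi * - b * k%:R ^+ a).
    by rewrite -sumrN; apply: eq_bigr => k _; rewrite mulrN mulNr sinN opprK.
  by rewrite normrN.
rewrite ger0_norm// in small *; set u := b * _ ^+ _.
have N0' : 0 < N%:R :> R by rewrite ltr0n.
have N1 : 1 <= N%:R :> R by rewrite ler1n.
have u0 : 0 <= u by rewrite mulr_ge0// exprn_ge0.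
have p2a : 1 <= 2 ^+ a :> R by rewrite exprn_ege1// ler1n.
have [pi2 pi4] : 2 <= pi :> R /\ pi < 4 :> R.
  by have := @pi_ge2 R; have := @pihalf_lt2 R; lra.
move: b0; rewrite le_eqVlt => /orP[/eqP b0|b0].
  rewrite big1 ?normr0; last by move=> k _; rewrite -b0 mulr0 mul0r sin0.
  by rewrite !mulr_ge0// ?addr_ge0 ?mulr_ge0 ?peak_ge0//; lra.
have u0' : 0 < u by rewrite mulr_gt0// exprn_gt0.
have bound1 : `|\sum_(N <= k < n) sin (2 * pi * b * k%:R ^+ a)| <= 8 * 2 ^+ a * (N%:R * u).
  apply: (le_trans (ler_norm_sum _ _ _)).
  apply: (@le_trans _ _ (\sum_(N <= k < n) 8 * 2 ^+ a * u)).
    rewrite [leLHS]big_nat [leRHS]big_nat; apply: ler_sum => k /andP[Nk kn].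
    apply: (le_trans (norm_sin_le _)).
    have k2 : k%:R ^+ a <= 2 ^+ a * N%:R ^+ a :> R.
      by rewrite -exprMn lerXn2r ?nnegrE ?mulr_ge0// -natrM ler_nat; natlia.
    rewrite ger0_norm; last by rewrite !mulr_ge0 ?exprn_ge0//; lra.
    apply: (le_trans (ler_wpM2l _ k2)); first by rewrite !mulr_ge0//; lra.
    rewrite [leLHS](_ : _ = 2 * pi * (2 ^+ a * u)); last by rewrite /u; ring.
    by rewrite -[leRHS]mulrA; apply: ler_wpM2r; [rewrite mulr_ge0//; lra|lra].
  rewrite sumr_const_nat -[leLHS]mulr_natr -mulrA; apply: ler_wpM2l; first lra.
  by rewrite mulrC ler_wpM2r// ler_nat; natlia.
have bound2 : `|\sum_(N <= k < n) sin (2 * pi * b * k%:R ^+ a)| <= 1 + 6 / (2 * pi * b * N%:R ^+ a.-1).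
  rewrite (eq_bigr (fun k => cos (2 * pi * b * k%:R ^+ a - pi / 2))); last first.
    by move=> k _; rewrite cosBpihalf.
  pose D k : R := \sum_(i < a) k.+1%:R ^+ (a.-1 - i) * k%:R ^+ i.
  have DE k : k.+1%:R ^+ a - k%:R ^+ a = D k.
    rewrite subrXX -natr1 [X in X * _]addrAC subrr add0r mul1r natr1.
    by apply: eq_bigr => i _; rewrite -subn1 -subnDA add1n.
  have Dmono k k' : (k <= k')%N -> D k <= D k'.
    move=> kk; apply: ler_sum => i _; apply: ler_pM; rewrite ?exprn_ge0//.
      by rewrite lerXn2r ?nnegrE// ler_nat ltnS.
    by rewrite lerXn2r ?nnegrE// ler_nat.
  have low k : (N <= k)%N -> N%:R ^+ a.-1 <= D k.
    move=> Nk; apply: le_trans (Dmono _ _ Nk); rewrite /D.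
    rewrite -(prednK a0) big_ord_recl/= subn0 expr0 mulr1.
    apply: (@le_trans _ _ (N.+1%:R ^+ a.-1)).
      by rewrite lerXn2r ?nnegrE// ler_nat.
    by rewrite lerDl sumr_ge0// => i _; rewrite mulr_ge0// exprn_ge0.
  have up k : (k < n)%N -> D k <= a%:R * (2 * N%:R) ^+ a.-1.
    move=> kn; apply: (@le_trans _ _ (\sum_(i < a) (2 * N%:R) ^+ a.-1)); last first.
      by rewrite sumr_const card_ord -[_ *+ a]mulr_natl.
    apply: ler_sum => i _.
    have ia : (i <= a.-1)%N by rewrite -ltnS prednK.
    rewrite -[in leRHS](subnK ia) exprD; apply: ler_pM; rewrite ?exprn_ge0//.
      by rewrite lerXn2r ?nnegrE ?mulr_ge0// -natrM ler_nat; natlia.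
    by rewrite lerXn2r ?nnegrE ?mulr_ge0// -natrM ler_nat; natlia.
  have pb : 0 < 2 * pi * b by rewrite !mulr_gt0//; lra.
  have fE k : 2 * pi * b * k.+1%:R ^+ a - pi / 2 - (2 * pi * b * k%:R ^+ a - pi / 2)
     = 2 * pi * b * D k.
    by rewrite -DE; ring.
  have small2 : 2 * pi * b * (a%:R * (2 * N%:R) ^+ a.-1) <= pi.
    have pi0 : 0 <= pi :> R by lra.
    have := ler_wpM2l pi0 small; lra.
  have dle : 2 * pi * b * N%:R ^+ a.-1 <= pi.
    apply: le_trans small2; apply: ler_wpM2l; first exact: ltW.
    have h : N%:R ^+ a.-1 <= (2 * N%:R) ^+ a.-1 :> R.
      by rewrite lerXn2r ?nnegrE ?mulr_ge0// ler_peMl// ler1n.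
    apply: (le_trans h); rewrite ler_peMl ?ler1n// exprn_ge0// mulr_ge0//.
  apply: (@kusmin_landau_nondecr R _ N n (2 * pi * b * N%:R ^+ a.-1)) => //.
  - by rewrite mulr_gt0// exprn_gt0.
  - move=> k /andP[Nk kn]; rewrite fE.
    have h1 := ler_wpM2l (ltW pb) (low k Nk).
    have h2 := ler_wpM2l (ltW pb) (up k kn).
    by rewrite h1/=; lra.
  - by move=> k Nk kn; rewrite !fE; apply: ler_wpM2l; [exact: ltW|exact: Dmono].
have bound3 : 6 / (2 * pi * b * N%:R ^+ a.-1) <= 3 / 2 * (N%:R * u^-1).
  have -> : u = b * N%:R ^+ a.-1 * N%:R by rewrite /u -(prednK a0) exprSr mulrA.
  have Na0 : 0 < N%:R ^+ a.-1 :> R by rewrite exprn_gt0.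
  have -> : N%:R * (b * N%:R ^+ a.-1 * N%:R)^-1 = (b * N%:R ^+ a.-1)^-1 :> R.
    by field; rewrite !gt_eqF.
  have bN : 0 < b * N%:R ^+ a.-1 by rewrite mulr_gt0.
  rewrite -[2 * pi * b * _]mulrA; rewrite ler_pdivrMr; last by rewrite !mulr_gt0//; lra.
  move: (b * N%:R ^+ a.-1) bN => w w0.
  have -> : 3 / 2 * w^-1 * (2 * pi * w) = 3 * pi by field; rewrite gt_eqF.
  lra.
rewrite /peak; have [uu|uu] := leP u u^-1.
  by apply: (le_trans bound1); rewrite ler_wpM2l ?lerDl//; lra.
apply: (le_trans bound2).
have Nu : 0 <= N%:R * u^-1 by rewrite mulr_ge0 ?invr_ge0 ?(ltW u0').
have : 1 * (N%:R * u^-1 + 1) <= 2 ^+ a * (N%:R * u^-1 + 1).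
  by rewrite ler_wpM2r//; lra.
lra.
Qed.

(** This is the weight factor of [abel_variation] for [g] sine or cosine; as [k ^ a] is monotone,
    the variation is at most the total phase. *)
Lemma sum_norm_lipschitz (g : R -> R) (b : R) (N n : nat) :
  (forall x y, `|g x - g y| <= `|x - y|) -> (forall x, `|g x| <= 1) ->
  (0 < N)%N -> (N <= n <= 2 * N)%N ->
  `|g (2 * pi * b * n%:R ^+ a)| + \sum_(N <= k < n)
     `|g (2 * pi * b * k.+1%:R ^+ a) - g (2 * pi * b * k%:R ^+ a)|
  <= 8 * 2 ^+ a * (1 + `|b| * N%:R ^+ a).
Proof.
move=> gl g1 N0 /andP[Nn nN].
have p2a : 1 <= 2 ^+ a :> R by rewrite exprn_ege1// ler1n.
have [pi2 pi4] : 2 <= pi :> R /\ pi < 4 :> R.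
  by have := @pi_ge2 R; have := @pihalf_lt2 R; lra.
have h : \sum_(N <= k < n) `|g (2 * pi * b * k.+1%:R ^+ a) - g (2 * pi * b * k%:R ^+ a)|
   <= 2 * pi * `|b| * n%:R ^+ a.
  apply: (@le_trans _ _ (\sum_(N <= k < n) 2 * pi * `|b| * (k.+1%:R ^+ a - k%:R ^+ a))).
    apply: ler_sum => k _; apply: (le_trans (gl _ _)).
    rewrite -mulrBr normrM [`|2 * pi * b|]normrM (ger0_norm (_ : 0 <= 2 * pi)); last lra.
    by rewrite [`|_ ^+ _ - _|]ger0_norm// subr_ge0 lerXn2r ?nnegrE// ler_nat.
  rewrite -mulr_sumr (telescope_sumr (fun k => k%:R ^+ a))//.
  rewrite ler_wpM2l//; first by rewrite !mulr_ge0//; lra.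
  by rewrite lerBlDr lerDl exprn_ge0.
have h2 : n%:R ^+ a <= 2 ^+ a * N%:R ^+ a :> R.
  by rewrite -exprMn lerXn2r ?nnegrE ?mulr_ge0// -natrM ler_nat.
have b0 := normr_ge0 b.
have h3 : 2 * pi * `|b| * n%:R ^+ a <= 2 * pi * `|b| * (2 ^+ a * N%:R ^+ a).
  by rewrite ler_wpM2l// !mulr_ge0//; lra.
have X0 : 0 <= `|b| * (2 ^+ a * N%:R ^+ a) by rewrite !mulr_ge0 ?exprn_ge0.
have h4 : 2 * pi * `|b| * (2 ^+ a * N%:R ^+ a) <= 8 * (`|b| * (2 ^+ a * N%:R ^+ a)).
  by rewrite -[2 * pi * _ * _]mulrA ler_wpM2r//; lra.
have := g1 (2 * pi * b * n%:R ^+ a); lra.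
Qed.

(** With [theta = p / q + b] the addition formula separates a [q]-periodic factor from a slow one.
    Only the mean of the periodic cosine leaves a main term; the mean-zero parts cost [q (1 + u)] by
    Abel summation. *)
Lemma major_arc (theta : R) (N n : nat) : (0 < N)%N -> (N <= n <= 2 * N)%N ->
  `|\sum_(N <= k < n) sin (2 * pi * theta * k%:R ^+ a)| <=
    40 * a%:R * 2 ^+ a *
    (N%:R * peak (`|theta - p%:~R / q%:R| * N%:R ^+ a) +
     q%:R * (1 + `|theta - p%:~R / q%:R| * N%:R ^+ a)).
Proof.
move=> N0 Nn; set b := theta - p%:~R / q%:R; set u := `|b| * _.
have a0 : (0 < a)%N by case: a a_odd.
have a1 : 1 <= a%:R :> R by rewrite ler1n.
have q1 : 1 <= q%:R :> R by rewrite ler1n.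
have p2a : 1 <= 2 ^+ a :> R by rewrite exprn_ege1// ler1n.
have Nn' := Nn; move: Nn' => /andP[Nn1 Nn2].
have N1 : 1 <= N%:R :> R by rewrite ler1n.
have u0 : 0 <= u by rewrite mulr_ge0// exprn_ge0.
have pu := peak_ge0 u0.
(* Otherwise [a 2^a u >= N], and the error term alone exceeds the trivial bound. *)
have [small|big] := leP (2 * a%:R * (2 * N%:R) ^+ a.-1 * `|b|) 1; last first.
  apply: (@le_trans _ _ N%:R).
    rewrite (le_trans (ler_norm_sum _ _ _))//.
    apply: (@le_trans _ _ (\sum_(N <= k < n) 1)).
      by apply: ler_sum => k _; exact: sin_max.
    by rewrite sumr_const_nat ler_nat; natlia.
  have h : N%:R <= a%:R * 2 ^+ a * u.
    have E : a%:R * 2 ^+ a * u = N%:R * (2 * a%:R * (2 * N%:R) ^+ a.-1 * `|b|).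
      by rewrite /u -{2 3}(prednK a0) exprMn !exprS; ring.
    by rewrite E ler_peMr// ltW.
  apply: (le_trans h).
  have h1 : a%:R * 2 ^+ a * u <= a%:R * 2 ^+ a * (40 * (N%:R * peak u + q%:R * (1 + u))).
    rewrite ler_wpM2l// ?mulr_ge0 ?exprn_ge0//.
    have : 1 * (1 + u) <= q%:R * (1 + u) by rewrite ler_wpM2r//; lra.
    have : 0 <= N%:R * peak u by rewrite mulr_ge0.
    lra.
  by apply: (le_trans h1); rewrite mulrA [_ * 40]mulrC !mulrA.
pose S := \sum_(0 <= k < q) cs k.
pose s := S / q%:R.
have S1 : `|s| <= 1.
  rewrite normrM normfV normr_nat ler_pdivrMr ?ltr0n// mul1r.
  rewrite (le_trans (ler_norm_sum _ _ _))//.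
  apply: (@le_trans _ _ (\sum_(0 <= k < q) 1)).
    by apply: ler_sum => k _; exact: cos_max.
  by rewrite sumr_const_nat subn0.
pose be k : R := 2 * pi * b * k%:R ^+ a.
have E : \sum_(N <= k < n) sin (2 * pi * theta * k%:R ^+ a) =
    s * (\sum_(N <= k < n) sin (be k)) +
    (\sum_(N <= k < n) sin (be k) * (cs k - s) +
     \sum_(N <= k < n) cos (be k) * sn k).
  rewrite mulr_sumr -!big_split/=; apply: eq_bigr => k _.
  have -> : 2 * pi * theta * k%:R ^+ a = be k + ratphase (k%:Z ^+ a).
    rewrite /be /ratphase /b intrM rmorphXn/= -pmulrn; field.
    by rewrite gt_eqF// ltr0n.
  by rewrite sinD -/(cs k) -/(sn k); ring.
have T1 := monomial_main_sum N0 Nn small.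
have T2 : `|\sum_(N <= k < n) sin (be k) * (cs k - s)| <=
    2 * q%:R * (8 * 2 ^+ a * (1 + u)).
  have hB m : (N <= m <= n)%N -> `|\sum_(N <= k < m) (cs k - s)| <= 2 * q%:R.
    move=> /andP[Nm _]; apply: periodic_sum_le => //.
    - by move=> k; rewrite cs_per.
    - move=> k; apply: (le_trans (ler_normB _ _)).
      by have := cos_max (ratphase (k%:Z ^+ a)); rewrite -/(cs k); lra.
    - rewrite sumrB sumr_const_nat subn0 -/S /s -[S / _ *+ _]mulr_natr divfK ?subrr//.
      by rewrite gt_eqF// ltr0n.
  apply: (le_trans (abel_variation (fun k => sin (be k)) Nn1 hB)).
  rewrite ler_wpM2l ?mulr_ge0//.
  by apply: sum_norm_lipschitz => //; [exact: norm_sinB_le|exact: sin_max].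
have T3 : `|\sum_(N <= k < n) cos (be k) * sn k| <= 1 * q%:R * (8 * 2 ^+ a * (1 + u)).
  have hB m : (N <= m <= n)%N -> `|\sum_(N <= k < m) sn k| <= 1 * q%:R.
    move=> /andP[Nm _]; apply: periodic_sum_le => //.
    by move=> k; exact: sin_max.
  apply: (le_trans (abel_variation (fun k => cos (be k)) Nn1 hB)).
  rewrite ler_wpM2l ?mulr_ge0//.
  by apply: sum_norm_lipschitz => //; [exact: norm_cosB_le|exact: cos_max].
rewrite -/u in T1.
have T1' : `|s * \sum_(N <= k < n) sin (be k)| <= 8 * 2 ^+ a * (N%:R * peak u + 1).
  by rewrite normrM -[leRHS]mul1r ler_pM.
rewrite E (le_trans (ler_normD _ _))//.
apply: (le_trans (lerD T1' (le_trans (ler_normD _ _) (lerD T2 T3)))).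
set Z := N%:R * peak u; set Q := q%:R * (1 + u).
have Z0 : 0 <= Z by rewrite mulr_ge0.
have Q1 : 1 <= Q by rewrite /Q -[leLHS]mulr1 ler_pM//; lra.
have ZQ : 0 <= 2 ^+ a * (Z + Q) by rewrite mulr_ge0//; lra.
have F1 : 2 ^+ a * (Z + 1) <= 2 ^+ a * (Z + Q) by rewrite ler_wpM2l//; lra.
have F2 : 2 ^+ a * Q <= 2 ^+ a * (Z + Q) by rewrite ler_wpM2l//; lra.
have F3 : 1 * (2 ^+ a * (Z + Q)) <= a%:R * (2 ^+ a * (Z + Q)) by rewrite ler_wpM2r.
rewrite (_ : 2 * q%:R * (8 * 2 ^+ a * (1 + u)) = 16 * (2 ^+ a * Q)); last by rewrite /Q; ring.
rewrite (_ : 1 * q%:R * (8 * 2 ^+ a * (1 + u)) = 8 * (2 ^+ a * Q)); last by rewrite /Q; ring.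
lra.
Qed.

End MajorArc.

(** * Block sums for odd powers, uniformly in [theta] *)

Section OddPower.
Variable R : realType.
Variable a : nat.
Hypothesis a_odd : odd a.

Let a0 : (0 < a)%N. Proof. by case: a a_odd. Qed.

Definition block (theta : R) (N n : nat) : R :=
  \sum_(N <= k < n) sin (2 * pi * theta * k%:R ^+ a).

Lemma norm_block_le theta (N n : nat) : `|block theta N n| <= (n - N)%:R.
Proof.
rewrite (le_trans (ler_norm_sum _ _ _))//.
apply: (@le_trans _ _ (\sum_(N <= k < n) 1)).
  by apply: ler_sum => k _; exact: sin_max.
by rewrite sumr_const_nat.
Qed.

Lemma weyl_block : exists C : nat, forall theta (N n K : nat), (0 < N)%N ->
  (N <= n <= 2 * N)%N -> (2 <= K)%N -> N%:R / K%:R <= `|block theta N n| ->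
  exists q (p : int), (0 < q <= K ^ C)%N /\
    `|q%:R * theta - p%:~R| <= K%:R ^+ C / N%:R ^+ a.
Proof.
have [C0 HC0] := weyl R a.-1; rewrite prednK// in HC0.
(* [a] pays for the block length, which is only known to be at least [N / K]; [K ^ a!] pays for the
   factorial of [phase_poly], moved into the denominator. *)
exists (C0 + a + a`!)%N => theta N n K N0 /andP[Nn nN] K2 Hb.
have K0n : (0 < K)%N by lia.
have K0 : 0 < K%:R :> R by rewrite ltr0n.
have N0' : 0 < N%:R :> R by rewrite ltr0n.
have nle : (n - N <= N)%N by lia.
have h1 : N%:R / K%:R <= (n - N)%:R :> R := le_trans Hb (norm_block_le theta N n).
have n0 : (0 < n - N)%N.
  by rewrite -(ltr0n R); apply: lt_le_trans h1; rewrite divr_gt0.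
(* The quarter turn converts the sine into a cosine. *)
pose P : {poly R} := theta *: ('X + N%:R%:P) ^+ a - (1 / 4)%:P.
have sX : size (('X + N%:R%:P : {poly R}) ^+ a) = a.+1.
  by rewrite -[N%:R%:P]opprK -rmorphN/= size_exp_XsubC.
have sP : (size P <= a.-1.+2)%N.
  rewrite prednK// (leq_trans (size_polyD _ _))// geq_max; apply/andP; split.
    by rewrite (leq_trans (size_scale_leq _ _))// sX.
  by rewrite size_polyN (leq_trans (size_polyC_leq1 _)).
have cP : P`_a = theta.
  rewrite coefB coefZ coefC gtn_eqF// subr0.
  have : lead_coef (('X + N%:R%:P : {poly R}) ^+ a) = 1.
    by apply/monicP/monic_exp/monicXaddC.
  by rewrite lead_coefE sX/= => ->; rewrite mulr1.
have := phase_poly sP; rewrite prednK// cP => Hph.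
have Eb : block theta N n = \sum_(0 <= k < n - N) cos (2 * pi * P.[k%:R]).
  rewrite /block -{1}[N]add0n big_addn; apply: eq_bigr => k _.
  rewrite /P hornerD hornerN hornerC hornerZ horner_exp hornerD hornerX hornerC.
  rewrite -cosBpihalf natrD; congr cos; by field.
have [|q /andP[q0 qK] [p hp]] := HC0 _ _ (n - N)%N K Hph n0 K2.
  rewrite -Eb; apply: le_trans Hb; rewrite ler_wpM2r ?invr_ge0 ?(ltW K0)//.
  by rewrite ler_nat.
exists (q * a`!)%N, p; split.
  rewrite muln_gt0 q0 fact_gt0/= !expnD; apply: leq_mul.
    by apply: (leq_trans qK); rewrite leq_pmulr// expn_gt0; lia.
  by apply: leq_trans (ltnW (ltn_expl _ K2)) _.
rewrite natrM -mulrA; apply: (le_trans hp).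
rewrite !exprD -!mulrA ler_pM2l ?exprn_gt0//.
apply: (@le_trans _ _ (K%:R ^+ a / N%:R ^+ a)).
  rewrite -expr_div_n -exprVn lerXn2r ?nnegrE ?invr_ge0 ?divr_ge0 ?(ltW K0)//.
  rewrite -[leRHS]invrK invf_div lef_pV2 ?posrE ?divr_gt0 ?ltr0n//.
rewrite ler_wpM2l ?exprn_ge0 ?(ltW K0)// ler_peMl ?invr_ge0 ?exprn_ge0//.
by rewrite exprn_ege1// ler1n; lia.
Qed.

Lemma exists_max (F : nat -> R) (N : nat) :
  exists2 i, (i <= N)%N & forall i', (i' <= N)%N -> F i' <= F i.
Proof.
elim: N => [|N [i iN Hi]].
  by exists 0%N => // i'; rewrite leqn0 => /eqP->.
have [h|h] := leP (F N.+1) (F i).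
  exists i; first exact: leqW.
  by move=> i'; rewrite leq_eqVlt => /orP[/eqP->//|]; exact: Hi.
exists N.+1 => // i'; rewrite leq_eqVlt => /orP[/eqP->//|i'N].
by apply: le_trans (ltW h); exact: Hi.
Qed.

Lemma exists_dyadic (x : R) : 0 < x -> x <= 1 ->
  exists2 i : nat, 2 ^- i.+1 <= x & x <= 2 * 2 ^- i.+1.
Proof.
move=> x0 x1.
have ex : exists i : nat, 2 ^- i.+1 <= x.
  exists (Num.truncn x^-1).
  have xi : 0 <= x^-1 by rewrite invr_ge0 ltW.
  have /andP[_ h] := truncn_itv xi.
  rewrite -[leRHS]invrK lef_pV2 ?posrE ?invr_gt0 ?exprn_gt0//.
  by apply: (le_trans (ltW h)); rewrite -natrX ler_nat ltnW// ltn_expl.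
pose P i := 2 ^- i.+1 <= x.
have := ex_minnP (ex : exists i, P i); case=> i Pi Hmin; exists i => //.
case: i Pi Hmin => [|i] Pi Hmin.
  by rewrite expr1 divff// pnatr_eq0.
have := Hmin i; rewrite ltnn /P leNgt => h.
have {}h : x <= 2 ^- i.+1.
  by rewrite leNgt; apply/negP => h'; move: h; rewrite ltNge ltW// => /(_ isT).
apply: (le_trans h); rewrite [2 ^+ i.+2]exprS invfM mulrA divff ?mul1r// pnatr_eq0//.
Qed.

(* At scale [2 ^ j], [s_phi] is the normalized size of the largest block sum and
   [2 ^- s_i] its dyadic order of magnitude. The scale is major ([s_maj]) when
   this size is large enough for the approximation [s_p / s_q] of [theta] to have
   a denominator below [2 ^ (j / 2)]. *)
Record scale_data := ScaleData {
  s_phi : R; s_maj : bool; s_q : nat; s_p : int; s_i : nat }.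

(** Taking [K = 2 ^ s_i] from the actual sum leaves two cases: either [s_i] is at least a multiple
    of [j], and the sum is exponentially small in [j], or the denominator is small enough for
    [major_arc]. *)
Lemma scale_lemma : exists C : nat, (0 < C)%N /\ forall theta (j : nat), exists s : scale_data,
  [/\ 0 <= s_phi s,
      forall n, (2 ^ j <= n <= 2 ^ j.+1)%N -> `|block theta (2 ^ j) n| <= 2 ^+ j * s_phi s,
      s_phi s != 0 -> s_phi s <= 2 * 2 ^- s_i s,
      ~~ s_maj s -> s_phi s != 0 -> (j <= 2 * C * s_i s)%N &
      s_maj s -> [/\ (2 * C * s_i s < j)%N, (0 < s_q s <= 2 ^ (C * s_i s))%N,
        `|(s_q s)%:R * theta - (s_p s)%:~R| <= 2 ^+ (C * s_i s) / (2 ^+ j) ^+ a &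
        2 ^+ j * s_phi s <= 40 * a%:R * 2 ^+ a *
         (2 ^+ j * peak (`|theta - (s_p s)%:~R / (s_q s)%:R| * (2 ^+ j) ^+ a)
          + 2 * 2 ^+ (C * s_i s))]].
Proof.
have [C' HC'] := weyl_block; pose C := C'.+1.
exists C; split => // theta j.
pose N := (2 ^ j)%N; have N0 : (0 < N)%N by rewrite expn_gt0.
have NR : N%:R = 2 ^+ j :> R by rewrite natrX.
have N0' : 0 < 2 ^+ j :> R by rewrite exprn_gt0.
have [i0 i0N Hmax] := exists_max (fun i => `|block theta N (N + i)|) N.
pose n := (N + i0)%N; pose phi := `|block theta N n| / 2 ^+ j.
have Nn : (N <= n <= 2 * N)%N by rewrite /n leq_addr mul2n -addnn leq_add2l.
have phi0 : 0 <= phi by rewrite divr_ge0// ltW.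
have phiE : 2 ^+ j * phi = `|block theta N n| by rewrite /phi mulrC divfK// gt_eqF.
have phimax m : (2 ^ j <= m <= 2 ^ j.+1)%N -> `|block theta (2 ^ j) m| <= 2 ^+ j * phi.
  move=> /andP[jm mj]; rewrite phiE -(subnKC jm); apply: Hmax.
  by rewrite leq_subLR addnn -mul2n -expnS.
have phi1 : phi <= 1.
  rewrite ler_pdivrMr// mul1r -NR (le_trans (norm_block_le _ _ _))// ler_nat.
  by rewrite /n addKn.
have [pz|pnz] := eqVneq phi 0.
  exists (ScaleData phi false 0 0 0) => /=; split => //.
    by rewrite pz eqxx.
  by rewrite pz eqxx.
have phip : 0 < phi by rewrite lt_def pnz.
have [i i1 i2] := exists_dyadic phip phi1.
have [minor|major] := leqP j (2 * C * i.+1).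
  by exists (ScaleData phi false 0 0 i.+1).
have [||q [p [/andP[q0 qK] hp]]] := HC' theta N n (2 ^ i.+1)%N N0 Nn.
- by rewrite -{1}(expn1 2) leq_exp2l.
- rewrite natrX NR -phiE ler_wpM2l// ltW//.
exists (ScaleData phi true q p i.+1); split => //=.
have CC : (C' * i.+1 <= C * i.+1)%N by rewrite leq_mul2r leqnSn orbT.
have hp' : `|q%:R * theta - p%:~R| <= 2 ^+ (C * i.+1) / (2 ^+ j) ^+ a.
  apply: (le_trans hp); rewrite NR natrX -exprM mulnC.
  rewrite ler_wpM2r ?invr_ge0 ?exprn_ge0// ?(ltW N0')//.
  by rewrite -!natrX ler_nat leq_exp2l.
have qK' : (q <= 2 ^ (C * i.+1))%N.
  by apply: (leq_trans qK); rewrite -expnM leq_exp2l// mulnC.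
split => //; first by rewrite q0.
rewrite phiE; apply: (le_trans (major_arc p q0 a_odd theta N0 Nn)).
rewrite NR ler_wpM2l; first by [].
  by rewrite !mulr_ge0// exprn_ge0.
(* [q (1 + u)] is [q] plus [|q theta - p| 2^(j a)], and each is at most [2 ^ (C s_i)]. *)
have twice (X : R) : 2 * X = X + X by ring.
rewrite lerD2l mulrDr mulr1 twice.
have qR : q%:R <= 2 ^+ (C * i.+1) :> R by rewrite -natrX ler_nat.
apply: lerD => //.
rewrite mulrA -[X in X * `|_|](ger0_norm (ler0n R q)) -normrM.
rewrite -ler_pdivlMr ?exprn_gt0//; apply: le_trans hp'.
by rewrite mulrBr mulrCA divff ?mulr1// gt_eqF// ltr0n.
Qed.

Lemma peak_sqr (w : R) : 0 <= w -> peak w ^+ 2 = peak (w ^+ 2).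
Proof.
move=> w0; rewrite /peak; have [h|h] := leP w w^-1.
  rewrite min_l// -exprVn lerXn2r ?nnegrE ?invr_ge0//.
rewrite min_r ?exprVn// -exprVn lerXn2r ?nnegrE ?invr_ge0//; exact: ltW.
Qed.

Lemma odd_block_bound : exists A : R, forall theta, exists phi : nat -> R,
  (forall J : nat, \sum_(j < J) phi j <= A) /\
  forall j n, (2 ^ j <= n <= 2 ^ j.+1)%N ->
    `|block theta (2 ^ j) n| <= 2 ^+ j * phi j.
Proof.
have [C [C0 HC]] := scale_lemma.
(* Chosen so that [2 ^ - i = rho ^ (4 C i)]: every inequality between [C s_i] and a scale becomes
   one between powers of [rho]. *)
pose rho : R := 2^-1 `^ ((4 * C)%:R^-1).
have C0' : 0 < (4 * C)%:R :> R by rewrite ltr0n muln_gt0.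
have rhoC : rho ^+ (4 * C) = 2^-1.
  by rewrite -powR_mulrn ?powR_ge0// /rho -powRrM mulVf ?gt_eqF// powRr1 ?invr_ge0.
have rho0 : 0 <= rho by exact: powR_ge0.
have rho1 : rho < 1.
  rewrite ltNge; apply/negP => h; have := exprn_ege1 (4 * C) h.
  by rewrite rhoC leNgt invf_lt1// ltr1n.
have rhole m n : (m <= n)%N -> rho ^+ n <= rho ^+ m.
  by move=> mn; rewrite ler_wiXn2l// ltW.
have half i : 2 ^- i = rho ^+ (4 * C * i) by rewrite exprM rhoC exprVn.
pose t : R := Num.sqrt (2 ^+ a).
have t2 : t ^+ 2 = 2 ^+ a by rewrite sqr_sqrtr ?exprn_ge0.
have t1 : 1 < t.
  by rewrite -sqrtr1 ltr_sqrt ?exprn_gt0// exprn_egt1// ?ltr1n//; case: a a0.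
pose A : R := 80 * a%:R * 2 ^+ a.
have a1 : 1 <= a%:R :> R by rewrite ler1n.
have p2a : 1 <= 2 ^+ a :> R by rewrite exprn_ege1// ler1n.
have aa1 : 1 <= a%:R * 2 ^+ a :> R by rewrite -[leLHS]mulr1 ler_pM.
have A80 : 80 <= A by rewrite /A; lra.
exists (A * ((1 - rho)^-1 + (2 * t / (t - 1) + (1 - rho)^-1) * (1 + (1 - rho)^-1))).
move=> theta.
have [s Hs] := choice (HC theta).
pose b j : R := (s_p (s j))%:~R / (s_q (s j))%:R.
exists (fun j => s_phi (s j)); split; last first.
  by move=> j n jn; have [_ h _ _ _] := Hs j; exact: h.
apply: (@class_sum R (fun j => s_phi (s j)) b (fun j => s_maj (s j)) A rho t theta) => //.
- lra.
- by move=> j; have [h _ _ _ _] := Hs j.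
- move=> j mj; have [h0 _ h1 h2 _] := Hs j.
  have [->|nz] := eqVneq (s_phi (s j)) 0; first by rewrite mulr_ge0 ?exprn_ge0//; lra.
  apply: (le_trans (h1 nz)); rewrite half.
  have h3 : rho ^+ (4 * C * s_i (s j)) <= rho ^+ j by apply: rhole; have := h2 mj nz; natnia.
  apply: ler_pM => //; [exact: exprn_ge0|lra].
- move=> j mj; have [h0 _ _ _ /(_ mj)[h1 /andP[q0 qK] h2 h3]] := Hs j.
  have N0' : 0 < 2 ^+ j :> R by rewrite exprn_gt0.
  rewrite peak_sqr; last by rewrite mulr_ge0 ?sqrtr_ge0 ?exprn_ge0//; lra.
  have -> : (Num.sqrt `|theta - b j| * t ^+ j) ^+ 2 = `|theta - b j| * (2 ^+ j) ^+ a.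
    by rewrite exprMn sqr_sqrtr// [t ^+ j ^+ 2]exprAC t2 [2 ^+ a ^+ j]exprAC.
  rewrite -(ler_pM2l N0'); apply: (le_trans h3).
  (* On a major scale [C s_i < j / 2], so the relative error is below [2 ^ (- j / 2)]. *)
  have e1 : 2 ^+ (C * s_i (s j)) <= 2 ^+ j * rho ^+ (2 * j).
    rewrite -ler_pdivrMl//.
    have cj : (C * s_i (s j) <= j)%N by natnia.
    have -> : (2 ^+ j)^-1 * 2 ^+ (C * s_i (s j)) = 2 ^- (j - C * s_i (s j)) :> R.
      by rewrite -{1}(subnK cj) exprD invfM -mulrA mulVf ?mulr1// gt_eqF// exprn_gt0.
    by rewrite half; apply: rhole; natnia.
  set pk := peak _.
  have pk0 : 0 <= 2 ^+ j * pk.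
    by rewrite mulr_ge0 ?(ltW N0')// peak_ge0// mulr_ge0// exprn_ge0// ltW.
  rewrite mulrCA /A.
  have -> : 80 * a%:R * 2 ^+ a = 40 * a%:R * 2 ^+ a * 2 :> R by ring.
  rewrite -[leRHS]mulrA; apply: ler_wpM2l; first by rewrite !mulr_ge0// exprn_ge0.
  lra.
- move=> m j mm mj lt bmj.
  have [_ _ _ _ /(_ mm)[m1 /andP[qm0 qmK] m2 _]] := Hs m.
  have [_ _ nz _ /(_ mj)[j1 /andP[qj0 qjK] j2 _]] := Hs j.
  have [->|/nz hphi] := eqVneq (s_phi (s j)) 0; first by rewrite mulr_ge0 ?exprn_ge0//; lra.
  move: bmj m1 qm0 qmK m2 j1 qj0 qjK j2 hphi; rewrite /b.
  move: (s_p (s m)) (s_q (s m)) (s_i (s m)) => pm qm im.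
  move: (s_p (s j)) (s_q (s j)) (s_i (s j)) => pj qj ij.
  move=> bmj m1 qm0 qmK m2 j1 qj0 qjK j2 hphi.
  have qm0' : 0 < qm%:R :> R by rewrite ltr0n.
  have qj0' : 0 < qj%:R :> R by rewrite ltr0n.
  (* Repulsion: [z] is a nonzero integer, yet both fractions approximate [theta], so
     [|z| <= 2 * 2^(C im + C ij) / 2^m]. Since [C im < m / 2], this makes [ij] large and
     [phi_j <= 2 * 2^-ij] small in terms of [m]. *)
  pose z := pm * qj%:Z - pj * qm%:Z.
  have z0 : z != 0.
    apply: contra bmj; rewrite subr_eq0 => /eqP/(congr1 (fun z : int => z%:~R : R)).
    rewrite !intrM -!pmulrn => h.
    by rewrite eqr_div ?lt0r_neq0//; apply/eqP.
  have z1 : 1 <= `|z%:~R : R|.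
    by rewrite -intr_norm -[1]/(1%:~R) ler_int -gtz0_ge1 normr_gt0.
  have E : z%:~R = qm%:R * (qj%:R * theta - pj%:~R) - qj%:R * (qm%:R * theta - pm%:~R) :> R.
    by rewrite /z intrB !intrM -!pmulrn; ring.
  have pow (k : nat) : 0 < 2 ^+ k :> R by rewrite exprn_gt0.
  have Na (k : nat) : 2 ^+ k <= (2 ^+ k) ^+ a :> R.
    by rewrite -{1}[2 ^+ k]expr1 ler_weXn2l// exprn_ege1// ler1n.
  have bd (X : R) (q' : nat) (k i1 i2 : nat) : (q' <= 2 ^ i1)%N -> (m <= k)%N ->
      `|X| <= 2 ^+ i2 / (2 ^+ k) ^+ a -> `|q'%:R * X| <= 2 ^+ (i1 + i2) / 2 ^+ m.
    move=> hq mk hX; rewrite normrM normr_nat exprD -mulrA; apply: ler_pM => //.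
      by rewrite -natrX ler_nat.
    apply: (le_trans hX); rewrite ler_wpM2l ?(ltW (pow _))// lef_pV2 ?posrE ?exprn_gt0//.
    by apply: le_trans (Na k); rewrite ler_weXn2l// ler1n.
  have b1 := bd _ _ _ _ _ qmK (ltnW lt) j2.
  have b2 := bd _ _ _ _ _ qjK (leqnn m) m2.
  rewrite addnC in b2.
  have : 1 <= 2 * 2 ^+ (C * im + C * ij) / 2 ^+ m :> R.
    apply: (le_trans z1); rewrite E; apply: (le_trans (ler_normB _ _)); lra.
  rewrite ler_pdivlMr// mul1r -exprS -!natrX ler_nat leq_exp2l// => hm.
  have hm' : (2 * m - 2 <= 4 * C * ij)%N by natnia.
  apply: (le_trans hphi); rewrite half.
  have r2 : 2^-1 <= rho ^+ 2 by rewrite -rhoC; apply: rhole; natnia.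
  have h1 : rho ^+ (4 * C * ij) * rho ^+ 2 <= rho ^+ (2 * m).
    by rewrite -exprD; apply: rhole; natlia.
  have h2 : rho ^+ (4 * C * ij) * 2^-1 <= rho ^+ (4 * C * ij) * rho ^+ 2.
    by rewrite ler_wpM2l// exprn_ge0.
  have rm0 : 0 <= rho ^+ (2 * m) by exact: exprn_ge0.
  have h3 : 80 * rho ^+ (2 * m) <= A * rho ^+ (2 * m) by rewrite ler_wpM2r.
  lra.
Qed.

End OddPower.

(** * Real powers *)

Section RealPower.
Variable R : realType.
Implicit Types (x p s : R).

Lemma powR_mvt p s : 0 < s ->
  exists2 c, s <= c <= s + 1 & (s + 1) `^ p - s `^ p = p * c `^ (p - 1).
Proof.
move=> s0.
have [|||c] := @MVT_segment R (@powR R ^~ p) (fun z => p * z `^ (p - 1)) s (s + 1).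
- lra.
- move=> z; rewrite in_itv/= => /andP[sz _]; apply: is_derive1_powR; lra.
- apply: derivable_within_continuous => z; rewrite in_itv/= => /andP[sz _].
  by apply: derivable_powR; rewrite in_itv/= andbT; lra.
rewrite in_itv/= => hc ->; exists c => //.
by rewrite addrAC subrr add0r mulr1.
Qed.

(** The mean value theorem is used twice: on the first difference [(t + 1)^p - t^p], then on the
    difference of powers in its derivative. *)
Lemma powR_second_mvt p s : 0 < s ->
  exists2 c, s <= c <= s + 2 &
    ((s + 2) `^ p - (s + 1) `^ p) - ((s + 1) `^ p - s `^ p) =
    p * (p - 1) * c `^ (p - 2).
Proof.
move=> s0.
have dG (z : R) : 0 < z -> is_derive z 1 (fun t : R => (t + 1) `^ p - t `^ p)
    (p * ((z + 1) `^ (p - 1) - z `^ (p - 1))).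
  move=> z0.
  have d1 : is_derive z 1 (@powR R ^~ p) (p * z `^ (p - 1)) by exact: is_derive1_powR.
  have d2 : is_derive (z + 1) 1 (@powR R ^~ p) (p * (z + 1) `^ (p - 1)).
    by apply: is_derive1_powR; lra.
  have d3 : is_derive z 1 (fun t : R => t + 1) 1.
    by apply: is_derive_eq; rewrite addr0.
  have d4 : is_derive z 1 ((@powR R ^~ p) \o (fun t : R => t + 1)) (p * (z + 1) `^ (p - 1)).
    by have := @is_derive1_comp R (@powR R ^~ p) (fun t : R => t + 1) z _ _ d2 d3; rewrite mulr1.
  have := is_deriveB d4 d1.
  by rewrite -mulrBr.
have dG' z : z \in `]s, s + 1[ -> is_derive z 1 (fun t : R => (t + 1) `^ p - t `^ p)
    (p * ((z + 1) `^ (p - 1) - z `^ (p - 1))).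
  by rewrite in_itv/= => /andP[sz _]; apply: dG; lra.
have [||c] := MVT_segment _ dG'.
- lra.
- apply: derivable_within_continuous => z; rewrite in_itv/= => /andP[sz _].
  by apply: ex_derive; apply: dG; lra.
rewrite in_itv/= => /andP[c1 c2].
have c0 : 0 < c by lra.
have [e /andP[e1 e2] E] := powR_mvt (p - 1) c0.
rewrite E => H; exists e; first by apply/andP; split; lra.
have -> : s + 2 = s + 1 + 1 by ring.
rewrite H; have -> : p - 1 - 1 = p - 2 by ring.
ring.
Qed.

Variable al : R.
Hypotheses (al0 : 0 < al) (al2 : al < 2) (al1 : al != 1).

(** [c1 x N^al / N^2] bounds the second differences of the phase from below; the 16 comes from
    intermediate points up to [4 N]. *)
Let c1 : R := `|al * (al - 1)| / 16.

Let c10 : 0 < c1.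
Proof.
by rewrite divr_gt0// normr_gt0 mulf_neq0 ?subr_eq0// lt0r_neq0.
Qed.

Lemma powR_quot1 p (z : R) : 0 < z -> z `^ (p - 1) = z `^ p / z.
Proof. by move=> z0; rewrite powRB ?powRr1 ?(ltW z0)// (gt_eqF z0) implybT. Qed.

Lemma powR_quot2 p (z : R) : 0 < z -> z `^ (p - 2) = z `^ p / z ^+ 2.
Proof.
by move=> z0; rewrite powRB ?powR_mulrn ?(ltW z0)// (gt_eqF z0) implybT.
Qed.

Lemma le_powR (p y z : R) : 0 <= p -> 0 <= y -> y <= z -> y `^ p <= z `^ p.
Proof. by move=> p0 y0 yz; apply: ge0_ler_powR => //; rewrite nnegrE// (le_trans y0). Qed.

Lemma powR_double_le (z : R) : 0 <= z -> (2 * z) `^ al <= 4 * z `^ al.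
Proof.
move=> z0; rewrite powRM// ler_wpM2r ?powR_ge0//.
apply: (@le_trans _ _ (2 `^ 2)); last by rewrite powR_mulrn// expr2; lra.
by apply: ler_powR; [rewrite ler1n|exact: ltW].
Qed.

Lemma power_block_trivial x (N n : nat) : 0 <= x -> (N <= n <= 2 * N)%N ->
  `|\sum_(N <= k < n) sin (k%:R `^ al * x)| <= 4 * N%:R * (x * N%:R `^ al).
Proof.
move=> x0 /andP[Nn nN].
apply: (le_trans (ler_norm_sum _ _ _)).
have U0 : 0 <= 4 * (x * N%:R `^ al) by rewrite !mulr_ge0 ?powR_ge0.
apply: (@le_trans _ _ (\sum_(N <= k < n) 4 * (x * N%:R `^ al))).
  rewrite [leLHS]big_nat [leRHS]big_nat; apply: ler_sum => k /andP[Nk kn].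
  apply: (le_trans (norm_sin_le _)).
  rewrite ger0_norm; last by rewrite mulr_ge0 ?powR_ge0.
  rewrite mulrC [leRHS]mulrCA; apply: ler_wpM2l => //.
  apply: le_trans (powR_double_le (ler0n _ _)).
  apply: le_powR => //; first exact: ltW.
  by rewrite -natrM ler_nat; natlia.
rewrite sumr_const_nat -[leLHS]mulr_natr.
rewrite [leRHS](_ : _ = 4 * (x * N%:R `^ al) * N%:R); last by ring.
by rewrite ler_wpM2l// ler_nat; natlia.
Qed.

Lemma power_block_vdc x (N n : nat) : 0 < x -> (0 < N)%N -> (N <= n <= 2 * N)%N ->
  let y := Num.sqrt (x * N%:R `^ al) in
  `|\sum_(N <= k < n) sin (k%:R `^ al * x)| <=
    (Num.sqrt c1 + 88 / Num.sqrt c1) * (y + N%:R / y).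
Proof.
move=> x0 N0 /andP[Nn nN] /=.
have N0' : 0 < N%:R :> R by rewrite ltr0n.
set U := N%:R `^ al; have U0 : 0 < U by rewrite powR_gt0.
have xU : 0 < x * U by rewrite mulr_gt0.
set y : R := Num.sqrt (x * U).
have y0 : 0 < y by rewrite sqrtr_gt0.
have y2 : y ^+ 2 = x * U by rewrite sqr_sqrtr// ltW.
set r : R := Num.sqrt c1.
have r0 : 0 < r by rewrite sqrtr_gt0 c10.
have r2 : r ^+ 2 = c1 by rewrite sqr_sqrtr// ltW.
have Ny0 : 0 < N%:R / y by rewrite divr_gt0.
(* [dl = sqrt lam] balances [1 / dl] against [dl / lam]. With about [y^2 / N + 1] periods at cost
   [N / y] each, the total is of order [y + N / y]. *)
pose dl := r * y / N%:R; pose lam := c1 * (x * U) / N%:R ^+ 2.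
have dl0 : 0 < dl by rewrite divr_gt0// mulr_gt0.
have lamE : lam = dl ^+ 2 by rewrite /lam /dl expr_div_n exprMn r2 y2.
have lam0 : 0 < lam by rewrite lamE exprn_gt0.
have [dl1|dl1] := leP dl 1; last first.
  apply: (@le_trans _ _ N%:R).
    rewrite (eq_bigr (fun k => cos (k%:R `^ al * x - pi / 2))); last first.
      by move=> k _; rewrite cosBpihalf.
    by rewrite (le_trans (norm_sum_cos_le _ _ _))// ler_nat; natlia.
  have : N%:R <= r * y by move: dl1; rewrite /dl ltr_pdivlMr// mul1r; exact: ltW.
  have : 0 <= r * (N%:R / y) by rewrite mulr_ge0 ?ltW.
  have : 0 <= 88 / r * (y + N%:R / y) by rewrite mulr_ge0 ?divr_ge0 ?addr_ge0 ?(ltW r0) ?(ltW y0) ?(ltW Ny0).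
  lra.
have pi2 := @pi_ge2 R.
have dlpi : dl <= pi by lra.
(* For [al < 1] the phase is concave in [k]; the sign makes the slopes increase, and the cosine is
   even. *)
pose sg : R := if 1 < al then 1 else -1.
have sgE : sg * (al * (al - 1)) = `|al * (al - 1)|.
  rewrite /sg; case: ifPn => h.
    by rewrite mul1r ger0_norm// mulr_ge0 ?subr_ge0 ?ltW.
  by rewrite mulN1r ler0_norm// mulr_ge0_le0 ?(ltW al0)// subr_le0 leNgt.
have sg1 : `|sg| = 1 by rewrite /sg; case: ifP; rewrite ?normrN normr1.
pose f k := sg * (k%:R `^ al * x - pi / 2).
rewrite (eq_bigr (fun k => cos (f k))); last first.
  by move=> k _; rewrite /f /sg; case: ifP; rewrite ?mul1r ?mulN1r ?cosN cosBpihalf.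
pose D := 8 * (x * U) / N%:R.
have D0 : 0 < D by rewrite divr_gt0// mulr_gt0.
have incr k : (N <= k)%N -> (k.+1 < n)%N ->
    f k.+1 - f k + lam <= f k.+2 - f k.+1.
  move=> Nk kn.
  have Nk' : N%:R <= k%:R :> R by rewrite ler_nat.
  have k0 : 0 < k%:R :> R by apply: lt_le_trans Nk'.
  have [c /andP[kc ck] E] := powR_second_mvt al k0.
  have c0 : 0 < c by lra.
  have -> : f k.+2 - f k.+1 = f k.+1 - f k + sg * (al * (al - 1)) * (x * c `^ (al - 2)).
    have := congr1 (fun z => sg * x * z) E.
    have -> : k%:R + 2 = k.+2%:R :> R by rewrite -!natr1; ring.
    by rewrite natr1 /f; lra.
  rewrite lerD2l sgE.
  have -> : `|al * (al - 1)| = 16 * c1 by rewrite /c1; field.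
  rewrite /lam powR_quot2//.
  have cN : c <= 4 * N%:R.
    apply: (le_trans ck); have : k.+2%:R <= (4 * N)%:R :> R by rewrite ler_nat; natlia.
    by rewrite natrM -!natr1; lra.
  have h1 : U <= c `^ al by apply: le_powR; [exact: ltW|exact: ltW|lra].
  have h2 : c ^+ 2 <= 16 * N%:R ^+ 2.
    have -> : 16 * N%:R ^+ 2 = (4 * N%:R) ^+ 2 :> R by ring.
    by rewrite lerXn2r ?nnegrE ?(ltW c0) ?mulr_ge0.
  have h3 : U / (16 * N%:R ^+ 2) <= c `^ al / c ^+ 2.
    apply: ler_pM; [exact: ltW| |exact: h1|].
      by rewrite invr_ge0; apply: mulr_ge0 => //; exact: sqr_ge0.
    by rewrite lef_pV2 ?posrE ?mulr_gt0 ?exprn_gt0.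
  have h4 : 0 <= 16 * c1 * x.
    by apply: mulr_ge0; [apply: mulr_ge0 => //; exact: ltW|exact: ltW].
  have := ler_wpM2l h4 h3.
  have -> : 16 * c1 * x * (U / (16 * N%:R ^+ 2)) = c1 * (x * U) / N%:R ^+ 2.
    by field; rewrite gt_eqF.
  by rewrite !mulrA.
have dbound k : (N <= k < n)%N -> `|f k.+1 - f k| <= D.
  move=> /andP[Nk kn].
  have Nk' : N%:R <= k%:R :> R by rewrite ler_nat.
  have k0 : 0 < k%:R :> R by apply: lt_le_trans Nk'.
  have [c /andP[kc ck] E] := powR_mvt al k0.
  have c0 : 0 < c by lra.
  have -> : f k.+1 - f k = sg * (x * (al * c `^ (al - 1))).
    by rewrite -E natr1 /f; ring.
  rewrite normrM sg1 mul1r powR_quot1// ger0_norm; last first.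
    by rewrite !mulr_ge0 ?invr_ge0 ?powR_ge0 ?ltW.
  have cN : c <= 2 * N%:R.
    by apply: (le_trans ck); rewrite natr1 -natrM ler_nat; natlia.
  have h1 : c `^ al <= 4 * U.
    apply: le_trans (powR_double_le (ltW N0')).
    by apply: le_powR => //; exact: ltW.
  have h2 : c `^ al / c <= 4 * U / N%:R.
    apply: ler_pM; rewrite ?powR_ge0 ?invr_ge0 ?(ltW c0)//.
    by rewrite lef_pV2 ?posrE//; lra.
  have h3 : al * (c `^ al / c) <= 2 * (4 * U / N%:R).
    by apply: ler_pM => //; [exact: ltW|rewrite mulr_ge0 ?powR_ge0 ?invr_ge0 ?ltW|exact: ltW].
  have := ler_wpM2l (ltW x0) h3; rewrite /D; lra.
have pp : 0 < 2 * pi :> R by lra.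
(* The [v] periods starting at [2 pi l] cover [[-D, D]]; beyond the truncation of [D / pi], one
   extra period compensates the floor and one the truncation. *)
pose l := Num.floor (- D / (2 * pi)).
pose v := (Num.truncn (D / pi)).+2.
have /andP[l1 l2] := floor_itv (- D / (2 * pi)); rewrite -/l intrD in l1 l2.
have Dp : 0 <= D / pi by rewrite divr_ge0 ?ltW//; lra.
have /andP[v1 v2] := truncn_itv Dp.
rewrite ler_pdivlMr// in l1; rewrite ltr_pdivrMr// in l2.
have pi0 : 0 < pi :> R by lra.
rewrite ltr_pdivrMr// in v2.
have vE : v%:R = (Num.truncn (D / pi)).+1%:R + 1 :> R by rewrite natr1.
have H := @van_der_corput R f lam dl lam0 dl0 dlpi v N n l Nn incr.
apply: (le_trans (H _)).
  move=> k /dbound; rewrite ler_norml => /andP[d1 d2].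
  rewrite vE; apply/andP; split; lra.
have vD : v%:R <= D + 2.
  rewrite vE -natr1; have : D / pi <= D by rewrite ler_pdivrMr// ler_peMr//; lra.
  lra.
have K1 : vdc_const lam dl <= 11 / dl.
  have E1 : dl / lam = 1 / dl by rewrite lamE; field; rewrite gt_eqF.
  rewrite /vdc_const E1.
  have : 1 <= 1 / dl by rewrite ler_pdivlMr// mul1r.
  lra.
have K0 : 0 <= 11 / dl by rewrite divr_ge0// ltW.
apply: (@le_trans _ _ ((D + 2) * (11 / dl))).
  apply: (@le_trans _ _ (v%:R * (11 / dl))); first by rewrite ler_wpM2l.
  by rewrite ler_wpM2r.
have -> : (D + 2) * (11 / dl) = 88 / r * y + 22 / r * (N%:R / y).
  by rewrite /D /dl -y2; field; rewrite !gt_eqF.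
have r1 : 0 < r^-1 by rewrite invr_gt0.
have e1 : 0 <= r * (y + N%:R / y) by rewrite mulr_ge0 ?addr_ge0 ?(ltW r0) ?(ltW y0) ?(ltW Ny0).
have e2 : 0 <= r^-1 * (N%:R / y) by rewrite mulr_ge0 ?ltW.
lra.
Qed.

Lemma power_block_bound (B : R) : exists A : R, forall x, `|x| <= B ->
  exists phi : nat -> R, (forall J : nat, \sum_(j < J) phi j <= A) /\
  forall j n, (2 ^ j <= n <= 2 ^ j.+1)%N ->
    `|\sum_(2 ^ j <= k < n) sin (k%:R `^ al * x)| <= 2 ^+ j * phi j.
Proof.
(* At scale [j] one has [y = w t^j], so [y / 2^j = w s^j], and [s < 1] because [al < 2]. *)
pose t : R := 2 `^ (al / 2); pose s := t / 2.
have t0 : 0 < t by rewrite powR_gt0.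
have gt1 (e : R) : 0 < e -> 1 < 2 `^ e :> R.
  move=> e0; have := @gt0_ltr_powR R e e0 1 2; rewrite !nnegrE powR1.
  by apply => //; rewrite ltr1n.
have t1 : 1 < t by apply: gt1; rewrite divr_gt0.
have t2 : t < 2.
  have h : 1 < 2 `^ (1 - al / 2) by apply: gt1; have := al2; lra.
  have E : t * 2 `^ (1 - al / 2) = 2.
    rewrite /t -powRD; last by rewrite pnatr_eq0 implybT.
    by rewrite subrKC powRr1.
  by rewrite -[ltRHS]E ltr_pMr.
have s1 : s < 1 by rewrite /s; lra.
have s0 : 0 <= s by rewrite /s; lra.
pose A1 := Num.sqrt c1 + 88 / Num.sqrt c1 + 4.
have A10 : 4 <= A1 by rewrite /A1 lerDr addr_ge0 ?divr_ge0 ?sqrtr_ge0.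
exists (A1 * (Num.sqrt B * (1 - s)^-1 + 2 * t / (t - 1))) => x xB.
pose w : R := Num.sqrt `|x|.
have w0 : 0 <= w by exact: sqrtr_ge0.
exists (fun j => A1 * (w * s ^+ j + peak (w * t ^+ j))); split.
  move=> J; rewrite -mulr_sumr; apply: ler_wpM2l; first lra.
  rewrite big_split/= -mulr_sumr; apply: lerD; last exact: sum_peak_le.
  apply: ler_pM => //; first by apply: sumr_ge0 => j _; exact: exprn_ge0.
    by rewrite ler_wsqrtr.
  exact: sum_geo_le.
move=> j n jn.
have N0 : (0 < 2 ^ j)%N by rewrite expn_gt0.
have NR : (2 ^ j)%N%:R = 2 ^+ j :> R by rewrite natrX.
have N0' : 0 < 2 ^+ j :> R by rewrite exprn_gt0.
have jn' : (2 ^ j <= n <= 2 * 2 ^ j)%N by rewrite -expnS.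
have -> : `|\sum_(2 ^ j <= k < n) sin (k%:R `^ al * x)| =
          `|\sum_(2 ^ j <= k < n) sin (k%:R `^ al * `|x|)|.
  have [x0|x0] := leP 0 x; first by rewrite (ger0_norm x0).
  rewrite (ltr0_norm x0) -normrN -sumrN; congr (`| _ |); apply: eq_bigr => k _.
  by rewrite mulrN sinN.
have Ut : (2 ^ j)%N%:R `^ al = (t ^+ j) ^+ 2 :> R.
  have t2E : t ^+ 2 = 2 `^ al.
    by rewrite -powR_mulrn ?powR_ge0// /t -powRrM divfK// pnatr_eq0.
  rewrite NR -[2 ^+ j]powR_mulrn// -powRrM mulrC powRrM powR_mulrn ?powR_ge0//.
  by rewrite -t2E exprAC.
have tj0 : 0 < t ^+ j by rewrite exprn_gt0.
set y : R := w * t ^+ j.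
have yE : `|x| * (2 ^ j)%N%:R `^ al = y ^+ 2 by rewrite Ut /y exprMn sqr_sqrtr.
have y0 : 0 <= y by rewrite mulr_ge0 ?(ltW tj0).
have ys : 2 ^+ j * (w * s ^+ j) = y.
  rewrite /s expr_div_n /y; field; by rewrite gt_eqF.
rewrite mulrCA mulrDr ys.
have B1 := power_block_trivial (normr_ge0 x) jn'; rewrite yE NR in B1.
have [y1|y1] := leP y 1.
  apply: (le_trans B1).
  have -> : peak y = y.
    move: y0; rewrite le_eqVlt => /orP[/eqP<-|yp]; first by rewrite /peak invr0 minxx.
    by rewrite /peak min_l// (le_trans y1)// invf_ge1.
  have yy : y ^+ 2 <= y by rewrite expr2 ler_piMr.
  have h1 := ler_wpM2l (ltW N0') yy.
  have h2 : 0 <= 2 ^+ j * y by rewrite mulr_ge0 ?(ltW N0').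
  have h3 : 4 * (2 ^+ j * y) <= A1 * (2 ^+ j * y) by rewrite ler_wpM2r.
  have h4 : 0 <= A1 * y by rewrite mulr_ge0//; lra.
  lra.
have x0 : 0 < `|x|.
  rewrite lt_def normr_ge0 andbT; apply/eqP => xz.
  by move: y1; rewrite /y /w xz sqrtr0 mul0r ltr10.
have B2 := power_block_vdc x0 N0 jn'.
rewrite yE sqrtr_sqr ger0_norm// NR in B2.
apply: (le_trans B2).
have -> : peak y = y^-1.
  by rewrite /peak min_r// (le_trans _ (ltW y1))// invf_le1//; lra.
have Z0 : 0 <= y + 2 ^+ j / y by rewrite addr_ge0// divr_ge0// ltW.
by rewrite ler_wpM2r// /A1; lra.
Qed.

End RealPower.

(** * Uniform convergence *)

Local Open Scope classical_set_scope.
Local Open Scope ring_scope.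

Section UniformConvergence.
Variable R : realType.

Lemma cvgn_cauchyP (u : nat -> R) :
  cvgn u <-> forall e : R, 0 < e -> exists N, forall L, (N <= L)%N -> `|u L - u N| <= e.
Proof.
split=> [/cvg_cauchy/cauchyP H e e0|H].
  have /cvg_ex[l Hl] : cvgn u by apply/cauchy_cvgP/cauchyP.
  have e2 : 0 < e / 2 by lra.
  have /cvgrPdist_le/(_ _ e2)[N _ HN] := Hl.
  exists N => L NL; have := HN L NL; have := HN N (leqnn N).
  by rewrite /= !ler_norml; lra.
apply/cauchy_cvgP/cauchy_exP => e e0.
have e2 : 0 < e / 2 by lra.
have [N HN] := H _ e2.
exists (u N); exists N => // L /= NL; rewrite /ball/= distrC.
by apply: le_lt_trans (HN _ NL) _; lra.
Qed.

Lemma converges_uniformly_onP (E : set R) (f : nat -> R -> R) :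
  converges_uniformly_on E f <->
  forall e : R, 0 < e -> exists N, forall L x, (N <= L)%N -> E x ->
    `|f L x - f N x| <= e.
Proof.
split=> [[g Hg] e e0|H].
  have e2 : 0 < e / 2 by lra.
  have : nbhs (g : {uniform` E -> R}) [set h | forall y, E y -> `|g y - h y| < e / 2].
    apply/uniform_nbhs; exists [set xy | `|xy.1 - xy.2| < e / 2]; split => //.
    rewrite -entourage_ballE; exists (e / 2) => //.
  move=> /Hg [N _ HN]; exists N => L x NL Ex.
  have /= h1 := HN L NL x Ex; have /= h2 := HN N (leqnn N) x Ex.
  by move: h1 h2; rewrite ltr_norml ltr_norml ler_norml; lra.
have cv x : E x -> cvgn (f ^~ x).
  move=> Ex; apply/cvgn_cauchyP => e /H[N HN]; exists N => L NL; exact: HN.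
exists (fun x => limn (f ^~ x)) => P /uniform_nbhs[U [entU UP]].
move: entU; rewrite -entourage_ballE => -[e /= e0 eU].
have e2 : 0 < e / 2 by lra.
have e4 : 0 < e / 4 by lra.
have [N HN] := H _ e4.
exists N => // L /= NL; apply: UP => x /= Ex; apply: eU => /=.
rewrite /ball/=.
have : `|limn (f ^~ x) - f N x| <= e / 4.
  have cx := cv _ Ex.
  have h : (fun L => `|f L x - f N x|) @ \oo --> `|limn (f ^~ x) - f N x|.
    by apply: cvg_norm; apply: cvgB => //; exact: cvg_cst.
  rewrite -(cvg_lim _ h)//; apply: limr_le; first by apply/cvg_ex; eexists; exact: h.
  by exists N => // l /= Nl; exact: HN.
have := HN L x NL Ex; rewrite !ler_norml ltr_norml; lra.
Qed.

Lemma dyadic_uniform (E : set R) (c : nat -> R) (b : nat -> R -> R) (C : R) :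
  (forall k, (1 <= k)%N -> 0 <= c k) ->
  (forall k l, (1 <= k)%N -> (k <= l)%N -> c l <= c k) ->
  (forall x, E x -> exists phi : nat -> R,
    (forall J : nat, \sum_(j < J) phi j <= C) /\
    forall j n, (2 ^ j <= n <= 2 ^ j.+1)%N ->
      `|\sum_(2 ^ j <= k < n) b k x| <= 2 ^+ j * phi j) ->
  (fun k : nat => c k * k%:R) @ \oo --> (0 : R) ->
  converges_uniformly_on E (fun L x => \sum_(1 <= k < L.+1) c k * b k x).
Proof.
move=> c0 cd Hb ck; apply/converges_uniformly_onP => e e0.
have C0 : 0 < `|C| + 1 by rewrite ltr_wpDl.
have e1 : 0 < e / (`|C| + 1) by rewrite divr_gt0.
have /cvgrPdist_le/(_ _ e1)[N _ HN] := ck.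
(* The partial sum with this index stops just before the block starting at [2 ^ N]. *)
exists (2 ^ N).-1 => L x NL /Hb[phi [phiC Hphi]].
have p2 j : (0 < 2 ^ j)%N by rewrite expn_gt0.
(* The empty block [n = 2 ^ j] forces the sign. *)
have phi0 j : 0 <= phi j.
  have := Hphi j (2 ^ j)%N; rewrite leqnn leq_exp2l//= leqnSn => /(_ isT).
  by rewrite big_geq// normr0 pmulr_rge0// exprn_gt0.
have main J n : (2 ^ N <= n <= 2 ^ (N + J))%N ->
    `|\sum_(2 ^ N <= k < n) c k * b k x| <=
      e / (`|C| + 1) * \sum_(j < N + J) phi j.
  have blk j n' : (N <= j)%N -> (2 ^ j <= n' <= 2 ^ j.+1)%N ->
      `|\sum_(2 ^ j <= k < n') c k * b k x| <= e / (`|C| + 1) * phi j.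
    move=> Nj /andP[jn nj].
    have := jn; rewrite leq_eqVlt => /orP[/eqP->|jn'].
      by rewrite big_geq// normr0 mulr_ge0// ltW.
    have h : `|\sum_(2 ^ j <= k < n') c k * b k x| <= 2 ^+ j * phi j * c (2 ^ j)%N.
      apply: abel_nonincr => //.
      - by move=> k /andP[jk _]; apply: c0; apply: leq_trans jk.
      - by move=> k jk _; apply: cd => //; apply: leq_trans jk.
      by move=> m /andP[jm mn]; apply: Hphi; rewrite jm (leq_trans mn).
    apply: (le_trans h); rewrite mulrAC ler_wpM2r// mulrC -natrX.
    have /= := HN (2 ^ j)%N; rewrite sub0r normrN => /(_ _)/(le_trans (ler_norm _)); apply.
    by rewrite (leq_trans Nj)// ltnW// ltn_expl.
  elim: J n => [|J IH] n /andP[Nn nN].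
    rewrite addn0 in nN *; rewrite big_geq// normr0.
    by rewrite mulr_ge0 ?(ltW e1)// sumr_ge0.
  rewrite addnS big_ord_recr/= mulrDr.
  have [nJ|/ltnW Jn] := leqP n (2 ^ (N + J)).
    by apply: ler_wpDr; [apply: mulr_ge0 => //; exact: ltW|apply: IH; rewrite Nn].
  have NJ : (2 ^ N <= 2 ^ (N + J))%N by rewrite leq_exp2l// leq_addr.
  rewrite (big_cat_nat NJ Jn)/= (le_trans (ler_normD _ _))// lerD//.
    by apply: IH; rewrite NJ leqnn.
  by apply: blk; [rewrite leq_addr|rewrite Jn -addnS].
have NL' : (2 ^ N <= L.+1)%N by rewrite -(prednK (p2 N)) ltnS.
rewrite prednK// (big_cat_nat _ NL')//= addrAC subrr add0r.
apply: (le_trans (main L.+1 L.+1 _)).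
  rewrite NL' /= (@leq_trans (2 ^ L.+1))//; first by rewrite ltnW// ltn_expl.
  by rewrite leq_exp2l// leq_addl.
rewrite mulrAC ler_pdivrMr// ler_wpM2l ?(ltW e0)//.
by apply: (le_trans (phiC _)); rewrite (le_trans (ler_norm C))// lerDl.
Qed.

End UniformConvergence.

(** * Necessity of [k c_k -> 0] *)

Section Necessity.
Variables (R : realType) (c : nat -> R).
Hypothesis c_ge0 : forall k : nat, (1 <= k)%N -> 0 <= c k.
Hypothesis c_noninc : forall k l : nat, (1 <= k)%N -> (k <= l)%N -> c l <= c k.

Lemma cvg_mul_nat_of_double : (forall e : R, 0 < e -> exists N, forall n, (N <= n)%N ->
    c (2 * n)%N * n%:R <= e) ->
  (fun k : nat => c k * k%:R) @ \oo --> (0 : R).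
Proof.
move=> H; apply/cvgrPdist_le => e e0.
have e4 : 0 < e / 4 by lra.
have [N HN] := H _ e4.
exists (2 * N + 2)%N => // k /= Nk; rewrite sub0r normrN.
have k1 : (1 <= k)%N by natlia.
rewrite ger0_norm ?mulr_ge0 ?c_ge0//.
have h : (2 * (k %/ 2) <= k)%N by natlia.
have h1 : (1 <= k %/ 2)%N by natlia.
have h2 : c k <= c (2 * (k %/ 2))%N by apply: c_noninc => //; natlia.
have h3 := HN (k %/ 2)%N; have {}h3 := h3 ltac:(natlia).
have h4 : k%:R <= 4 * (k %/ 2)%:R :> R by rewrite -natrM ler_nat; natlia.
have h5 : 0 <= (k %/ 2)%:R :> R by [].
have h6 := c_ge0 k1.
have h7 : c k * k%:R <= c k * (4 * (k %/ 2)%:R) by rewrite ler_wpM2l.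
have h8 : c k * (4 * (k %/ 2)%:R) <= c (2 * (k %/ 2))%N * (4 * (k %/ 2)%:R).
  by rewrite ler_wpM2r// mulr_ge0.
lra.
Qed.

Lemma necessity (alpha gamma : R) (E : set R) : 0 < alpha -> 2 <= gamma ->
  contains_discrete_nbhd0 alpha gamma E ->
  converges_uniformly_on E (sin_partial_sum c alpha) ->
  (fun k : nat => c k * k%:R) @ \oo --> (0 : R).
Proof.
move=> a0 g2 [x [N N0 Hx] xE] /converges_uniformly_onP H.
have g0 : 0 < gamma by lra.
have ga0 : 0 < gamma `^ (alpha + 1) by rewrite powR_gt0.
have ga1 : gamma `^ (alpha + 1) = gamma `^ alpha * gamma.
  by rewrite powRD ?powRr1 ?(ltW g0)// (gt_eqF g0) implybT.
have gaa : 1 <= gamma `^ alpha.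
  by rewrite -[leLHS](powRr0 gamma) ler_powR ?(ltW a0)//; lra.
have pi0 := pi_gt0 R.
pose s := sin (pi / gamma `^ (alpha + 1)).
have pg2 : pi / gamma `^ (alpha + 1) <= pi / 2.
  rewrite ler_pM2l// lef_pV2 ?posrE// ga1 -[leLHS]mul1r ler_pM//.
have pg0 : 0 < pi / gamma `^ (alpha + 1) by rewrite divr_gt0.
have s0 : 0 < s.
  by apply: sin_gt0_pi; apply/andP; split => //; lra.
apply: cvg_mul_nat_of_double => e e0.
have e1 : 0 < e * s / 2 by rewrite !mulr_gt0.
have [N1 HN1] := H _ e1.
exists (N + N1)%N => n nN.
have n0 : (0 < n)%N by natlia.
(* The shift by [N] selects the point of modulus [pi / (gamma^(alpha+1) n^alpha)]. *)
have Ex : E (x (n - N)%N) by apply: xE; exists (n - N)%N.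
have := HN1 (2 * n)%N _ _ Ex; move=> /(_ ltac:(natlia)).
have := HN1 n _ _ Ex; move=> /(_ ltac:(natlia)) h1 h2.
have {h1 h2} : `|sin_partial_sum c alpha (2 * n) (x (n - N)%N) -
    sin_partial_sum c alpha n (x (n - N)%N)| <= e * s.
  by move: h1 h2; rewrite !ler_norml; lra.
set y := x (n - N)%N.
have ny : `|y| = pi / (gamma `^ (alpha + 1) * n%:R `^ alpha).
  by rewrite /y Hx subnKC//; natlia.
have -> : sin_partial_sum c alpha (2 * n) y - sin_partial_sum c alpha n y =
   \sum_(n.+1 <= k < (2 * n).+1) c k * sin (k%:R `^ alpha * y).
  rewrite /sin_partial_sum (@big_cat_nat _ _ _ n.+1)//=; first by rewrite addrAC subrr add0r.
  natlia.
have -> : `|\sum_(n.+1 <= k < (2 * n).+1) c k * sin (k%:R `^ alpha * y)| =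
  `|\sum_(n.+1 <= k < (2 * n).+1) c k * sin (k%:R `^ alpha * `|y|)|.
  have [y0|y0] := leP 0 y; first by rewrite (ger0_norm y0).
  rewrite (ltr0_norm y0) -normrN -sumrN; congr (`| _ |); apply: eq_bigr => k _.
  by rewrite mulrN sinN mulrN.
move=> h; rewrite -(ler_pM2r s0); apply: le_trans h; apply: le_trans (ler_norm _).
have -> : c (2 * n)%N * n%:R * s = \sum_(n.+1 <= k < (2 * n).+1) c (2 * n)%N * s.
  rewrite sumr_const_nat; have -> : ((2 * n).+1 - n.+1)%N = n by natlia.
  by rewrite -[RHS]mulr_natr; ring.
rewrite [leLHS]big_nat [leRHS]big_nat; apply: ler_sum => k /andP[nk kn].
have k0 : (1 <= k)%N by natlia.
have n0' : 0 < n%:R `^ alpha :> R by rewrite powR_gt0// ltr0n.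
apply: ler_pM; rewrite ?c_ge0 ?(ltW s0)//; first natlia.
  by apply: c_noninc.
have z1 : pi / gamma `^ (alpha + 1) <= k%:R `^ alpha * `|y|.
  rewrite ny invfM [leRHS](_ : _ = pi / gamma `^ (alpha + 1) * (k%:R `^ alpha / n%:R `^ alpha)); last by ring.
  rewrite ler_peMr ?(ltW pg0)// ler_pdivlMr// mul1r.
  by rewrite ge0_ler_powR ?nnegrE ?(ltW a0)// ler_nat; natlia.
(* As [k <= 2 n <= gamma n], the argument is at most [pi / gamma <= pi / 2], the range where the
   sine increases. *)
have z2 : k%:R `^ alpha * `|y| <= pi / 2.
  have hk : k%:R `^ alpha <= gamma `^ alpha * n%:R `^ alpha.
    rewrite -powRM ?(ltW g0)// ge0_ler_powR ?nnegrE ?(ltW a0) ?mulr_ge0 ?(ltW g0)//.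
    apply: (@le_trans _ _ (2 * n%:R)); last by rewrite ler_wpM2r.
    by rewrite -natrM ler_nat; natlia.
  apply: (le_trans (ler_wpM2r (normr_ge0 y) hk)).
  rewrite ny ga1.
  have -> : gamma `^ alpha * n%:R `^ alpha * (pi / (gamma `^ alpha * gamma * n%:R `^ alpha)) = pi / gamma.
    field; rewrite !gt_eqF//; lra.
  by rewrite ler_pM2l// lef_pV2 ?posrE.
move: z1; rewrite le_eqVlt => /orP[/eqP<-//|z1].
apply: ltW; rewrite /s ltr_sin// in_itv/=; apply/andP; split; lra.
Qed.

End Necessity.

(** * The even, odd and real cases *)

Section Assembly.
Variables (R : realType) (c : nat -> R).
Hypothesis c_ge0 : forall k : nat, (1 <= k)%N -> 0 <= c k.
Hypothesis c_noninc : forall k l : nat, (1 <= k)%N -> (k <= l)%N -> c l <= c k.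

Lemma partial_sumB (u : nat -> R) (N L : nat) : (N <= L)%N ->
  \sum_(1 <= k < L.+1) u k - \sum_(1 <= k < N.+1) u k = \sum_(N.+1 <= k < L.+1) u k.
Proof.
by move=> NL; rewrite (@big_cat_nat _ _ _ N.+1)//= addrAC subrr add0r.
Qed.

Lemma summable_uniform (al : R) (E : set R) :
  cvgn (fun L : nat => \sum_(1 <= k < L.+1) c k) ->
  converges_uniformly_on E (sin_partial_sum c al).
Proof.
move=> /cvgn_cauchyP H; apply/converges_uniformly_onP => e /H[N HN].
exists N => L x NL _; apply: le_trans (HN L NL).
rewrite /sin_partial_sum !partial_sumB//; apply: (le_trans (ler_norm_sum _ _ _)).
apply: le_trans (ler_norm _); rewrite [leLHS]big_nat [leRHS]big_nat.
apply: ler_sum => k /andP[Nk _]; have ck := c_ge0 (leq_ltn_trans (leq0n N) Nk).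
by rewrite normrM (ger0_norm ck) ler_piMr// sin_max.
Qed.

(** The sines select a subseries with no two consecutive gaps; by monotonicity it dominates the full
    series up to a factor 2. *)
Lemma summable_of_point (al x0 s : R) (e : nat -> bool) (E : set R) :
  0 < s -> (forall k : nat, sin (k%:R `^ al * x0) = s * (e k)%:R) ->
  (forall k, e k || e k.+1) -> E x0 ->
  converges_uniformly_on E (sin_partial_sum c al) ->
  cvgn (fun L : nat => \sum_(1 <= k < L.+1) c k).
Proof.
move=> s0 He ee Ex /converges_uniformly_onP H; apply/cvgn_cauchyP => eps eps0.
have e1 : 0 < s * eps / 2 by rewrite divr_gt0// mulr_gt0.
have [N HN] := H _ e1.
exists N.+1 => L NL; rewrite partial_sumB//.
rewrite ger0_norm; last first.
  by rewrite big_nat sumr_ge0// => k /andP[Nk _]; apply: c_ge0; natlia.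
have := HN L x0 (ltnW NL) Ex; rewrite /sin_partial_sum partial_sumB ?(ltnW NL)//.
rewrite (eq_bigr (fun k => s * (c k * (e k)%:R))); last first.
  by move=> k _; rewrite He mulrCA.
rewrite -mulr_sumr => /(le_trans (ler_norm _)); rewrite -mulrA ler_pM2l// => h.
pose T k := c k * (e k)%:R.
have T0 k : (1 <= k)%N -> 0 <= T k by move=> k1; rewrite mulr_ge0// c_ge0.
have h1 : \sum_(N.+2 <= k < L.+1) T k <= \sum_(N.+1 <= k < L.+1) T k.
  by rewrite [leRHS]big_ltn ?ltnS ?(ltnW NL)// lerDr T0.
have h2 : \sum_(N.+1 <= k < L) T k <= \sum_(N.+1 <= k < L.+1) T k.
  by rewrite [leRHS]big_nat_recr ?(ltnW NL)//= lerDl T0//; natlia.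
(* Termwise, [c (k+2) <= T (k+1) + T (k+2)], because [e] holds at [k+1] or [k+2]. *)
apply: (@le_trans _ _ (\sum_(N.+1 <= k < L) T k + \sum_(N.+2 <= k < L.+1) T k)); last first.
  by rewrite /T in h1 h2 *; lra.
rewrite !big_add1/= -big_split/= [leLHS]big_nat [leRHS]big_nat.
apply: ler_sum => k /andP[Nk _].
have ckk := c_noninc (ltn0Sn k) (leqnSn k.+1).
have := ee k.+1; have := T0 k.+1 isT; have := T0 k.+2 isT; rewrite /T.
have := c_ge0 (ltn0Sn k); have := c_ge0 (ltn0Sn k.+1).
by case: (e k.+1); case: (e k.+2) => //=; rewrite ?mulr1 ?mulr0; lra.
Qed.

Lemma expn_even_mod4 (a k : nat) : (0 < a)%N -> ~~ odd a ->
  ((k ^ a) %% 4 = odd k)%N.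
Proof.
move=> a0 ea; have -> : a = (2 * a./2)%N by rewrite mul2n even_halfK.
have h0 : (0 < a./2)%N by rewrite half_gt0; case: a a0 ea => [|[|]].
rewrite expnM -modnXm; have -> : ((k ^ 2) %% 4 = odd k)%N.
  rewrite -{1}(odd_double_half k) -mul2n sqrnD.
  by case: (odd k); rewrite ?mul1n ?mul0n expnMn; lia.
by case: (odd k); rewrite ?exp1n ?exp0n.
Qed.

Lemma expn_even_mod3 (a k : nat) : (0 < a)%N -> ~~ odd a ->
  ((k ^ a) %% 3 = (k %% 3 != 0))%N.
Proof.
move=> a0 ea; have -> : a = (2 * a./2)%N by rewrite mul2n even_halfK.
have h0 : (0 < a./2)%N by rewrite half_gt0; case: a a0 ea => [|[|]].
rewrite expnM -modnXm; have -> : ((k ^ 2) %% 3 = (k %% 3 != 0))%N.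
  rewrite -modnXm; have := @ltn_pmod k 3 isT.
  by case: (k %% 3)%N => [|[|[|]]].
by case: (_ != 0%N); rewrite ?exp1n ?exp0n.
Qed.

Lemma even_case (a : nat) (E : set R) : (0 < a)%N -> ~~ odd a ->
  (exists m : int, E (pi / 2 + 2 * pi * m%:~R) \/
                   E (2 * pi / 3 + 2 * pi * m%:~R)) ->
  (converges_uniformly_on E (sin_partial_sum c a%:R) <->
   cvgn (fun L : nat => \sum_(1 <= k < L.+1) c k)).
Proof.
move=> a0 ea [m Em]; split; last exact: summable_uniform.
(* Modulo [2 pi] the argument depends only on [k ^ a] modulo [d]; [pi / 2] is the case [d = 4]. *)
have red (d k : nat) : (0 < d)%N ->
    sin (k%:R `^ a%:R * (2 * pi / d%:R + 2 * pi * m%:~R)) =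
    sin (2 * pi / d%:R * ((k ^ a) %% d)%N%:R) :> R.
  move=> d0; rewrite powR_mulrn//.
  rewrite -[RHS](sinD2pi_int _ (((k ^ a) %/ d)%N%:Z + (k ^ a)%N%:Z * m)).
  congr sin; rewrite intrD intrM -!pmulrn -natrX.
  have -> : ((k ^ a) %% d)%:R = (k ^ a)%N%:R - ((k ^ a) %/ d)%:R * d%:R :> R.
    by rewrite {2}(divn_eq (k ^ a) d) natrD natrM addrAC subrr add0r.
  by field; rewrite pnatr_eq0 -lt0n.
case: Em => Em.
- have h4 : pi / 2 = 2 * pi / 4%:R :> R by field.
  apply: (@summable_of_point a%:R (pi / 2 + 2 * pi * m%:~R) 1 odd) => //.
    move=> k; rewrite h4 red// expn_even_mod4// mul1r.
    have -> : 2 * pi / 4%:R = pi / 2 :> R by field.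
    by case: (odd k); rewrite ?mulr1 ?mulr0 ?sin_pihalf ?sin0.
  by move=> k /=; case: (odd k).
- apply: (@summable_of_point a%:R (2 * pi / 3 + 2 * pi * m%:~R) (sin (2 * pi / 3))
    (fun k => (k %% 3 != 0)%N)) => //.
  + have pi0 := pi_gt0 R; apply: sin_gt0_pi; apply/andP; split; lra.
  + move=> k; rewrite red// expn_even_mod3//.
    by case: (_ != 0%N); rewrite ?mulr1 ?mulr0 ?sin0.
  + by move=> k /=; lia.
Qed.

Lemma odd_uniform (a : nat) (E : set R) : odd a ->
  (fun k : nat => c k * k%:R) @ \oo --> (0 : R) ->
  converges_uniformly_on E (sin_partial_sum c a%:R).
Proof.
move=> oa ck; have [A HA] := odd_block_bound R oa.
apply: (@dyadic_uniform R E c (fun k x => sin (k%:R `^ a%:R * x)) A) => // x _.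
have [phi [h1 h2]] := HA (x / (2 * pi)); exists phi; split => // j n jn.
apply: le_trans (h2 j n jn); rewrite le_eqVlt; apply/orP; left; apply/eqP.
congr (`| _ |); apply: eq_bigr => k _; congr sin; rewrite powR_mulrn//.
have pi0 : 0 < 2 * pi :> R by rewrite mulr_gt0// pi_gt0.
by rewrite [_ * (x / _)]mulrC divfK ?lt0r_neq0// mulrC.
Qed.

Lemma power_uniform (al : R) (E : set R) : 0 < al -> al < 2 -> bounded_set E ->
  (fun k : nat => c k * k%:R) @ \oo --> (0 : R) ->
  converges_uniformly_on E (sin_partial_sum c al).
Proof.
move=> al0 al2 [M [_ HM]] ck.
have [->|al1] := eqVneq al 1; first exact: (@odd_uniform 1).
have [A HA] := power_block_bound al0 al2 al1 (M + 1).
apply: (@dyadic_uniform R E c (fun k x => sin (k%:R `^ al * x)) A) => // x Ex.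
by apply: HA; apply: (HM (M + 1)) => //; rewrite ltrDl.
Qed.

End Assembly.

Theorem theorem2 (R : realType) (c : nat -> R)
  (c_ge0 : forall k : nat, (1 <= k)%N -> 0 <= c k)
  (c_noninc : forall k l : nat, (1 <= k)%N -> (k <= l)%N -> c l <= c k) :
  (forall (a : nat) (E : set R),
     (0 < a)%N -> ~~ odd a ->
     (exists m : int, E (pi / 2 + 2 * pi * m%:~R) \/
                      E (2 * pi / 3 + 2 * pi * m%:~R)) ->
     (converges_uniformly_on E (sin_partial_sum c a%:R) <->
      cvgn (fun L : nat => \sum_(1 <= k < L.+1) c k))) /\
  (forall (a : nat) (E : set R),
     odd a ->
     (exists2 gamma : R, 2 <= gamma & contains_discrete_nbhd0 a%:R gamma E) ->
     (converges_uniformly_on E (sin_partial_sum c a%:R) <->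
      (fun k : nat => c k * k%:R) @ \oo --> (0 : R))) /\
  (forall (alpha : R) (E : set R),
     0 < alpha -> alpha < 2 ->
     bounded_set E ->
     (exists2 gamma : R, 2 <= gamma & contains_discrete_nbhd0 alpha gamma E) ->
     (converges_uniformly_on E (sin_partial_sum c alpha) <->
      (fun k : nat => c k * k%:R) @ \oo --> (0 : R))).
Proof.
split; [|split].
- by move=> a E a0 ea HE; exact: even_case.
- move=> a E oa [g g2 HE]; split; last exact: odd_uniform.
  by apply: necessity HE => //; rewrite ltr0n; case: a oa.
- move=> al E al0 al2 bE [g g2 HE]; split; last exact: power_uniform.
  exact: necessity HE.
Qed.
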